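(* There is $K>0$ such that the basis $(v_j)_{j=1}^{\infty}$ of $Z(\mathcal S^2)$ has the $E(n,n,K)$-property for all $n\in\mathbb N$.
   Context: All Banach spaces are complex. **Derived spaces.** Let $\omega$ be the space of all complex sequences with coordinatewise convergence and $(e_j)$ the unit vectors. Let $X$ be a Banach sequence space and let its dual $X^*$ be regarded as a sequence space through the bilinear pairing $\langle x,y\rangle=\sum_j x_jy_j$; assume $(e_j)$ is an unconditional basis of both $X$ and $X^*$. Let $\mathbb S=\{z\in\mathbb C:0\le \mathrm{Re}\, z\le 1\}$. $\mathcal F_\infty(X,X^* )$ is the space of functions $F:\mathbb S\to\omega$ that are bounded and continuous on $\mathbb S$, analytic in the interior of $\mathbb S$, and such that $t\mapsto F(it)\in X$ and $t\mapsto F(1+it)\in X^*$ are bounded continuous functions, with norm $\|F\|=\max(\sup_t\|F(it)\|_X,\sup_t\|F(1+it)\|_{X^*})$. The interpolation space $(X,X^* )_{1/2}=\{F(1/2):F\in\mathcal F_\infty(X,X^* )\}$ carries the quotient norm. When $(X,X^* )_{1/2}=\ell_2$ (with equivalent norms), the derived space $Z(X)$ is the space of pairs $(x,y)\in\omega\times\omega$ for which $\|(x,y)\|_{Z(X)}=\inf\{\|F\|:F\in\mathcal F_\infty(X,X^* ),\ F(1/2)=y,\ F'(1/2)=x\}$ is finite. Its natural basis is $(v_j)_{j\ge1}$ with $v_{2j-1}=(e_j,0)$, $v_{2j}=(0,e_j)$. **The space $\mathcal S^2$.** A finite set $A=\{n_1<\dots<n_k\}\subset\mathbb N$ is admissible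 if $k\le n_1$. The Schreier space $\mathcal S$ is the completion of the space $c_{00}$ of finitely supported sequences under $\|x\|_{\mathcal S}=\sup_{A}\sum_{j\in A}|x_j|$, the supremum over admissible $A$. Its 2-convexification $\mathcal S^2$ is the completion of $c_{00}$ under $\|x\|_{\mathcal S^2}=\sup_A(\sum_{j\in A}|x_j|^2)^{1/2}$. One has $(\mathcal S^2,(\mathcal S^2)^* )_{1/2}=\ell_2$ with equivalent norms. **$E(n,m,K)$-property.** A basis (or a family $(b_j)$ indexed by a subset of $\mathbb N$) is $(m,K)$-euclidean if for every subset $A$ of the index set with $|A|\le m$, $(b_j)_{j\in A}$ is $K$-equivalent to the unit vector basis of $\ell_2^{|A|}$. A basis $(b_j)_{j\ge1}$ has the $E(n,m,K)$-property if there is $I\subseteq\mathbb N$ with $|I|=n$ such that $\{b_j:j\in\mathbb N\setminus I\}$ is $(m,K)$-euclidean. *)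

(* Defs.v *)
(* Stdlib / Coquelicot world: the complex field is Coquelicot's C.

   Sequences are indexed from 0: the coordinate j : nat of a sequence stands
   for the coordinate j + 1 of a sequence indexed by {1, 2, 3, ...}.  The
   same shift applies to families of vectors and to their index sets. *)

From Stdlib Require Import Reals List.
From Coquelicot Require Import Coquelicot.

Open Scope R_scope.

Definition omega : Type := nat -> C.

Definition omega_minus (x y : omega) : omega := fun j => (x j - y j)%C.

Definition omega_zero : omega := fun _ => 0%C.

Definition unit_vector (j : nat) : omega :=
  fun k => if Nat.eqb k j then 1%C else 0%C.

Definition finitely_supported (x : omega) : Prop :=
  exists N : nat, forall j : nat, (N <= j)%nat -> x j = 0%C.

(* Finite subsets of nat are represented by duplicate-free lists. *)
Definition lsum {G : AbelianMonoid} (f : nat -> G) (A : list nat) : G :=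
  fold_right (fun j s => plus (f j) s) zero A.

(* A normed space of sequences; the value of [norm_of] is meaningful on
   members only. *)
Record seq_space : Type := SeqSpace {
  mem_of : omega -> Prop;
  norm_of : omega -> R
}.

(* The completion of c_00 under N, realized inside omega as the N-closure of
   c_00.  Here N is given on all of omega by the formula that defines the norm
   on c_00, with values in [0, +oo]. *)
Definition c00_completion (N : omega -> Rbar) : seq_space := {|
  mem_of := fun x => forall eps : R, 0 < eps ->
    exists y, finitely_supported y /\ Rbar_lt (N (omega_minus x y)) eps;
  norm_of := fun x => real (N x)
|}.

(* The dual of X as a space of sequences: y stands for the bounded linear
   functional x |-> sum_j x_j y_j on X (bilinear pairing, no conjugation). *)
Definition dual (X : seq_space) : seq_space := {|
  mem_of := fun y => exists M : R, forall x, mem_of X x ->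
    exists s : C, is_series (fun j => (x j * y j)%C) s /\
                  Cmod s <= M * norm_of X x;
  norm_of := fun y => real (Lub_Rbar (fun r => exists (x : omega) (s : C),
    mem_of X x /\ norm_of X x <= 1 /\
    is_series (fun j => (x j * y j)%C) s /\ r = Cmod s))
|}.

Definition bounded_continuous (X : seq_space) (g : R -> omega) : Prop :=
  (forall t, mem_of X (g t)) /\
  (exists M : R, forall t, norm_of X (g t) <= M) /\
  (forall t (eps : R), 0 < eps -> exists delta : R, 0 < delta /\
     forall s, Rabs (s - t) < delta ->
       norm_of X (omega_minus (g s) (g t)) < eps).

Definition strip (z : C) : Prop := 0 <= Re z <= 1.

Definition left_side (F : C -> omega) (t : R) : omega := F (t * Ci)%C.
Definition right_side (F : C -> omega) (t : R) : omega := F (1 + t * Ci)%C.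

(* Functions on the strip are represented by functions on C whose values
   outside the strip are irrelevant.  Boundedness, continuity and analyticity
   of an omega-valued function refer to the topology of omega, that is, to
   coordinatewise convergence.  Coquelicot's own uniform structure on nat -> C
   is that of uniform convergence, hence the explicit coordinates. *)
Record F_infty (X Y : seq_space) (F : C -> omega) : Prop := {
  F_bounded : forall j, exists M : R, forall z, strip z -> Cmod (F z j) <= M;
  F_continuous : forall j z, strip z ->
    filterlim (fun w : C => F w j) (within strip (locally z))
              (locally (F z j));
  F_analytic : forall j (z : C), 0 < Re z < 1 ->
    ex_derive (fun w : C => F w j) z;
  F_left : bounded_continuous X (left_side F);
  F_right : bounded_continuous Y (right_side F)
}.

Definition sup_R (f : R -> R) : R :=
  real (Lub_Rbar (fun r => exists t, r = f t)).

Definition F_norm (X Y : seq_space) (F : C -> omega) : R :=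
  Rmax (sup_R (fun t => norm_of X (left_side F t)))
       (sup_R (fun t => norm_of Y (right_side F t))).

(* The norm of the derived space Z(X), with value +oo exactly on the pairs
   (x, y) outside Z(X).  The first component is the derivative. *)
Definition derived_norm (X : seq_space) (p : omega * omega) : Rbar :=
  Glb_Rbar (fun r => exists F : C -> omega,
    F_infty X (dual X) F /\
    (forall j, F (RtoC (1 / 2)) j = snd p j) /\
    (forall j, is_derive (fun w : C => F w j) (RtoC (1 / 2)) (fst p j)) /\
    r = F_norm X (dual X) F).

(* Even indices carry (e_j, 0) and odd ones (0, e_j), because of the shift of
   the indices by 1. *)
Definition derived_basis (j : nat) : omega * omega :=
  if Nat.even j then (unit_vector (Nat.div2 j), omega_zero)
  else (omega_zero, unit_vector (Nat.div2 j)).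

(* The bound |A| <= min A of 1-based indices reads |A| <= j + 1 for all
   j in A. *)
Definition admissible (A : list nat) : Prop :=
  NoDup A /\ forall j, In j A -> (length A <= j + 1)%nat.

Definition l2_norm (A : list nat) (a : nat -> C) : R :=
  sqrt (lsum (fun j => Cmod (a j) ^ 2) A).

Definition schreier2_norm (x : omega) : Rbar :=
  Lub_Rbar (fun r => exists A, admissible A /\ r = l2_norm A x).

Definition schreier2 : seq_space := c00_completion schreier2_norm.

Definition lincomb (A : list nat) (a : nat -> C) (b : nat -> omega * omega) :
    omega * omega :=
  (fun k => lsum (fun j => (a j * fst (b j) k)%C) A,
   fun k => lsum (fun j => (a j * snd (b j) k)%C) A).

(* K-equivalence of (b_j) for j in A, with norm N, and the unit vector basis
   of l_2^A. *)
Definition l2_equivalent (N : omega * omega -> Rbar)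
    (b : nat -> omega * omega) (K : R) (A : list nat) : Prop :=
  forall a : nat -> C,
    Rbar_le (/ K * l2_norm A a) (N (lincomb A a b)) /\
    Rbar_le (N (lincomb A a b)) (K * l2_norm A a).

Definition euclidean (N : omega * omega -> Rbar)
    (b : nat -> omega * omega) (J : nat -> Prop) (m : nat) (K : R) : Prop :=
  forall A : list nat, NoDup A -> (length A <= m)%nat ->
    (forall j, In j A -> J j) -> l2_equivalent N b K A.

Definition E_property (N : omega * omega -> Rbar)
    (b : nat -> omega * omega) (n m : nat) (K : R) : Prop :=
  exists I : list nat, NoDup I /\ length I = n /\
    euclidean N b (fun j => ~ In j I) m K.

(* Main.v *)
Require Import Defs.
From Stdlib Require Import Reals Lra Lia List Classical ClassicalEpsilon FinFun.
From Coquelicot Require Import Coquelicot.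

(** Take away the first [n] basis vectors. A combination of at most [n] of the
    others is a pair [(x, y)] whose entries sit on a set [B] of at most [n]
    coordinates [k], all with [n <= 2 * k + 1], and such a [B] is a union of two
    admissible sets ([split_admissible]). On vectors supported by [B] the norms
    of the 2-convexified Schreier space and of its dual are therefore within a
    factor 2 of the Euclidean norm. It remains to compare the derived norm of
    [(x, y)] with [|x|_2 + |y|_2], as if both end spaces were Euclidean
    ([derived_norm_bounds]).

    From above, [F z = y + mobius z * x] has value [y] and derivative [x] at 1/2
    and takes its values among the vectors supported by [B]; here [mobius] is a
    bounded function on the strip with value 0 and derivative 1 at 1/2.

    From below, let [F] have value [y] and derivative [x] at 1/2, and let [u] be
    a vector supported by [B]. The scalar function [f z = sum_(j in B) u_j F_j z]
    is bounded and analytic on the strip, and [|f| <= 2 |F| |u|_2] on the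
    boundary. The values [f (1/2)] and [f' (1/2)] are bounded by a multiple of
    the supremum of [|f|] over the boundary ([analytic_value_bound],
    [analytic_derivative_bound]), and the duality of [l_2(B)] with itself turns
    these bounds into bounds of [|y|_2] and [|x|_2].

    The bound of [f' (1/2)] is Cauchy's formula: with the origin moved to 1/2,
    integrate [f z / z ^ 2] around tall rectangles that fill the strip. The
    kernel decays, so the horizontal sides disappear, and the vertical sides
    give a multiple of the supremum over the boundary. As [f] is only known to
    be complex differentiable, the deformation of contours rests on Goursat's
    bisection ([goursat]). The bound of [f (1/2)] is the same bound for
    [mobius * f], whose derivative at 1/2 is [f (1/2)]. *)

(** * Complex differentiability *)

(** The epsilon-delta form of the complex derivative. It depends on the modulus
    alone, so that the different uniform structures carried by the complex
    numbers stay out of the estimates; [is_derive_cderive] makes the link. *)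
Definition cderive (f : C -> C) (z l : C) : Prop :=
  forall eps, 0 < eps -> exists delta, 0 < delta /\
    forall w, Cmod (w - z) < delta ->
      Cmod (f w - f z - l * (w - z)) <= eps * Cmod (w - z).

Definition ccont (f : C -> C) (z : C) : Prop :=
  forall eps, 0 < eps -> exists delta, 0 < delta /\
    forall w, Cmod (w - z) < delta -> Cmod (f w - f z) < eps.

Lemma is_derive_cderive (f : C -> C) (z l : C) :
  is_derive f z l <-> cderive f z l.
Proof.
  split.
  - intros [_ H] eps Heps.
    destruct (H z (fun P HP => HP) (mkposreal eps Heps)) as [d Hd].
    exists d; split; [apply cond_pos|].
    intros w Hw. specialize (Hd w Hw). rewrite Cmult_comm. exact Hd.
  - intros H. split.
    + apply is_linear_scal_l.
    + intros x Hx.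
      assert (x = z) as -> by (symmetry; apply (is_filter_lim_locally_unique (V := AbsRing_NormedModule C_AbsRing)); exact Hx).
      intros eps. destruct (H eps (cond_pos eps)) as [d [Hd0 Hd]].
      exists (mkposreal d Hd0). intros w Hw. specialize (Hd w Hw).
      rewrite Cmult_comm in Hd. exact Hd.
Qed.

Lemma cderive_ccont f z l : cderive f z l -> ccont f z.
Proof.
  intros H eps Heps.
  destruct (H 1 Rlt_0_1) as [d [Hd Hf]].
  pose proof (Cmod_ge_0 l) as Hl.
  assert (He : 0 < eps / (2 + Cmod l)) by (apply Rdiv_lt_0_compat; lra).
  exists (Rmin d (eps / (2 + Cmod l))); split.
  { apply Rmin_pos; lra. }
  intros w Hw.
  assert (H1 : Cmod (w - z) < d) by (eapply Rlt_le_trans; [exact Hw | apply Rmin_l]).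
  assert (H2 : Cmod (w - z) < eps / (2 + Cmod l)) by (eapply Rlt_le_trans; [exact Hw | apply Rmin_r]).
  specialize (Hf w H1).
  replace (f w - f z)%C with ((f w - f z - l * (w - z)) + l * (w - z))%C by ring.
  eapply Rle_lt_trans; [apply Cmod_triangle|]. rewrite Cmod_mult.
  pose proof (Cmod_ge_0 (w - z)).
  assert ((2 + Cmod l) * Cmod (w - z) < eps).
  { apply Rmult_lt_compat_l with (r := 2 + Cmod l) in H2; [|lra].
    replace ((2 + Cmod l) * (eps / (2 + Cmod l))) with eps in H2 by (field; lra). exact H2. }
  nra.
Qed.

Lemma cderive_plus f g z l m : cderive f z l -> cderive g z m ->
  cderive (fun w => f w + g w)%C z (l + m)%C.
Proof.
  intros Hf Hg eps Heps.
  destruct (Hf (eps / 2)) as [d1 [Hd1 H1]]; [lra|].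
  destruct (Hg (eps / 2)) as [d2 [Hd2 H2]]; [lra|].
  exists (Rmin d1 d2); split; [apply Rmin_pos; lra|].
  intros w Hw.
  specialize (H1 w (Rlt_le_trans _ _ _ Hw (Rmin_l _ _))).
  specialize (H2 w (Rlt_le_trans _ _ _ Hw (Rmin_r _ _))).
  replace (f w + g w - (f z + g z) - (l + m) * (w - z))%C
    with ((f w - f z - l * (w - z)) + (g w - g z - m * (w - z)))%C by ring.
  eapply Rle_trans; [apply Cmod_triangle|]. lra.
Qed.

Lemma cderive_const k z : cderive (fun _ => k) z 0%C.
Proof.
  intros eps Heps. exists 1; split; [lra|]. intros w _.
  replace (k - k - 0 * (w - z))%C with (RtoC 0) by ring.
  rewrite Cmod_0. pose proof (Cmod_ge_0 (w - z)). nra.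
Qed.

Lemma cderive_id z : cderive (fun w => w) z 1%C.
Proof.
  intros eps Heps. exists 1; split; [lra|]. intros w _.
  replace (w - z - 1 * (w - z))%C with (RtoC 0) by ring.
  rewrite Cmod_0. pose proof (Cmod_ge_0 (w - z)). nra.
Qed.

Lemma cderive_mult f g z l m : cderive f z l -> cderive g z m ->
  cderive (fun w => f w * g w)%C z (l * g z + f z * m)%C.
Proof.
  intros Hf Hg eps Heps.
  pose proof (Cmod_ge_0 (f z)) as Pf. pose proof (Cmod_ge_0 (g z)) as Pg. pose proof (Cmod_ge_0 l) as Pl.
  set (S := 3 * (1 + Cmod (f z) + Cmod (g z) + Cmod l)).
  assert (HS : 3 <= S) by (unfold S; lra).
  assert (He : 0 < eps / S) by (apply Rdiv_lt_0_compat; lra).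
  destruct (Hf _ He) as [d1 [Hd1 H1]].
  destruct (Hg _ He) as [d2 [Hd2 H2]].
  destruct (cderive_ccont _ _ _ Hg (Rmin 1 (eps / S))) as [d3 [Hd3 H3]].
  { apply Rmin_pos; lra. }
  exists (Rmin d1 (Rmin d2 d3)); split; [repeat apply Rmin_pos; lra|].
  intros w Hw.
  pose proof (Rmin_l d1 (Rmin d2 d3)). pose proof (Rmin_r d1 (Rmin d2 d3)).
  pose proof (Rmin_l d2 d3). pose proof (Rmin_r d2 d3).
  specialize (H1 w ltac:(lra)). specialize (H2 w ltac:(lra)). specialize (H3 w ltac:(lra)).
  pose proof (Rmin_l 1 (eps / S)). pose proof (Rmin_r 1 (eps / S)).
  replace (f w * g w - f z * g z - (l * g z + f z * m) * (w - z))%C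
    with ((f w - f z - l * (w - z)) * (g z + (g w - g z))
          + (l * (w - z) * (g w - g z) + f z * (g w - g z - m * (w - z))))%C by ring.
  pose proof (Cmod_ge_0 (w - z)) as Hwz.
  assert (Hg1 : Cmod (g z + (g w - g z)) <= Cmod (g z) + 1).
  { eapply Rle_trans; [apply Cmod_triangle|]. lra. }
  assert (K1 : Cmod ((f w - f z - l * (w - z)) * (g z + (g w - g z)))
     <= eps / S * Cmod (w - z) * (Cmod (g z) + 1)).
  { rewrite Cmod_mult. apply Rmult_le_compat; auto using Cmod_ge_0. }
  assert (K2 : Cmod (l * (w - z) * (g w - g z)) <= Cmod l * Cmod (w - z) * (eps / S)).
  { rewrite !Cmod_mult. apply Rmult_le_compat; auto using Cmod_ge_0, Rmult_le_pos; lra. }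
  assert (K3 : Cmod (f z * (g w - g z - m * (w - z))) <= Cmod (f z) * (eps / S * Cmod (w - z))).
  { rewrite Cmod_mult. apply Rmult_le_compat_l; auto. }
  eapply Rle_trans; [apply Cmod_triangle|].
  eapply Rle_trans; [apply Rplus_le_compat_l, Cmod_triangle|].
  eapply Rle_trans; [apply Rplus_le_compat; [exact K1 | apply Rplus_le_compat; [exact K2 | exact K3]]|].
  replace (eps * Cmod (w - z)) with (eps / S * Cmod (w - z) * S) by (field; lra).
  assert (0 <= eps / S * Cmod (w - z)) by (apply Rmult_le_pos; lra).
  apply Rle_trans with (eps / S * Cmod (w - z) * (1 + Cmod (f z) + Cmod (g z) + Cmod l)); [right; ring|].
  apply Rmult_le_compat_l; [assumption|]. unfold S. lra.
Qed.

Lemma cderive_inv (z : C) : z <> 0%C -> cderive (fun w => / w)%C z (- / (z * z))%C.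
Proof.
  intros Hz eps Heps.
  pose proof (proj1 (Cmod_gt_0 z) Hz) as Hm.
  exists (Rmin (Cmod z / 2) (eps * (Cmod z) ^ 3 / 2)). split.
  { apply Rmin_pos; [lra|]. pose proof (pow_lt _ 3 Hm). nra. }
  intros w Hw.
  pose proof (Rlt_le_trans _ _ _ Hw (Rmin_l _ _)) as H1.
  pose proof (Rlt_le_trans _ _ _ Hw (Rmin_r _ _)) as H2.
  assert (Hw2 : Cmod z / 2 < Cmod w).
  { pose proof (Cmod_triangle w (z - w)) as Ht.
    replace (w + (z - w))%C with z in Ht by ring.
    replace (z - w)%C with (- (w - z))%C in Ht by ring. rewrite Cmod_opp in Ht. lra. }
  assert (Hw0 : w <> 0%C) by (apply Cmod_gt_0; lra).
  replace (/ w - / z - - / (z * z) * (w - z))%C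
    with ((w - z) * ((w - z) * / (w * z * z)))%C by (field; auto).
  rewrite !Cmod_mult, Cmod_inv by (repeat apply Cmult_neq_0; auto). rewrite !Cmod_mult.
  rewrite (Rmult_comm eps). apply Rmult_le_compat_l; [apply Cmod_ge_0|].
  assert (Hp : 0 < Cmod w * Cmod z * Cmod z) by (repeat apply Rmult_lt_0_compat; lra).
  apply Rmult_le_reg_r with (1 := Hp). rewrite Rmult_assoc, Rinv_l, Rmult_1_r by lra.
  assert (Cmod z / 2 * (Cmod z * Cmod z) <= Cmod w * (Cmod z * Cmod z)).
  { apply Rmult_le_compat_r; nra. }
  eapply Rle_trans; [apply Rlt_le, H2|].
  apply Rmult_le_compat_l with (r := eps) in H; [|lra].
  simpl. lra.
Qed.

Lemma cderive_comp_affine f (a b : C) z l : cderive f (a + b * z)%C l ->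
  cderive (fun w => f (a + b * w)%C) z (b * l)%C.
Proof.
  intros Hf eps Heps. pose proof (Cmod_ge_0 b) as Hb.
  assert (He : 0 < eps / (1 + Cmod b)) by (apply Rdiv_lt_0_compat; lra).
  destruct (Hf _ He) as [d [Hd H]].
  exists (d / (1 + Cmod b)); split; [apply Rdiv_lt_0_compat; lra|].
  intros w Hw. pose proof (Cmod_ge_0 (w - z)).
  assert (E : (a + b * w - (a + b * z))%C = (b * (w - z))%C) by ring.
  assert (Hlt : (1 + Cmod b) * Cmod (w - z) < d).
  { apply Rmult_lt_compat_l with (r := 1 + Cmod b) in Hw; [|lra].
    replace ((1 + Cmod b) * (d / (1 + Cmod b))) with d in Hw by (field; lra). exact Hw. }
  specialize (H (a + b * w)%C). rewrite E, Cmod_mult in H.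
  replace (b * l * (w - z))%C with (l * (b * (w - z)))%C by ring.
  eapply Rle_trans; [apply H; nra|].
  replace (eps * Cmod (w - z)) with (eps / (1 + Cmod b) * ((1 + Cmod b) * Cmod (w - z))) by (field; lra).
  apply Rmult_le_compat_l; nra.
Qed.

Lemma cderive_ext f g z l : (forall w, f w = g w) -> cderive f z l -> cderive g z l.
Proof.
  intros E H eps Heps. destruct (H eps Heps) as [d [Hd K]]. exists d; split; auto.
  intros w Hw. rewrite <- !E. auto.
Qed.

(** * Circulations and Goursat's lemma *)

(** The real part of the integral of [g] along the boundary of the rectangle
    [a <= x <= b], [c <= y <= d], run counterclockwise, with opposite sides
    grouped. The real part suffices because [g] can be multiplied by a
    constant; so only real integrals occur. *)
Definition circulation (g : C -> C) (a b c d : R) : R :=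
  RInt (fun x => Re (g (x, c)) - Re (g (x, d))) a b
  + RInt (fun y => Im (g (a, y)) - Im (g (b, y))) c d.

Lemma Cmod_horizontal (x x' c : R) : Cmod ((x, c) - (x', c))%C = Rabs (x - x').
Proof.
  rewrite <- Cmod_R. f_equal. unfold Cminus, Cplus, Copp, RtoC; simpl. f_equal; ring.
Qed.

Lemma Cmod_vertical (x y y' : R) : Cmod ((x, y) - (x, y'))%C = Rabs (y - y').
Proof.
  replace ((x, y) - (x, y'))%C with (Ci * RtoC (y - y'))%C.
  - rewrite Cmod_mult, Cmod_Ci, Cmod_R. ring.
  - unfold Cminus, Cplus, Copp, RtoC, Cmult, Ci; simpl. f_equal; ring.
Qed.

Lemma im_le_Cmod (c : C) : Rabs (Im c) <= Cmod c.
Proof. eapply Rle_trans; [apply Rmax_r|]. apply Rmax_Cmod. Qed.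

Lemma Re_minus (u v : C) : Re (u - v) = Re u - Re v.
Proof. reflexivity. Qed.

Lemma Im_minus (u v : C) : Im (u - v) = Im u - Im v.
Proof. reflexivity. Qed.

Lemma ccont_horizontal g x c : ccont g (x, c) -> continuous (fun t => Re (g (t, c))) x.
Proof.
  intros H. apply (filterlim_locally_ball_norm (U := R_NormedModule)). intros eps. destruct (H eps (cond_pos eps)) as [d [Hd K]].
  exists (mkposreal d Hd). intros t Ht.
  change (Rabs (Re (g (t, c)) - Re (g (x, c))) < eps).
  rewrite <- Re_minus. eapply Rle_lt_trans; [apply re_le_Cmod|].
  apply K. rewrite Cmod_horizontal. exact Ht.
Qed.

Lemma ccont_vertical g x y : ccont g (x, y) -> continuous (fun t => Im (g (x, t))) y.
Proof.
  intros H. apply (filterlim_locally_ball_norm (U := R_NormedModule)). intros eps. destruct (H eps (cond_pos eps)) as [d [Hd K]].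
  exists (mkposreal d Hd). intros t Ht.
  change (Rabs (Im (g (x, t)) - Im (g (x, y))) < eps).
  rewrite <- Im_minus. eapply Rle_lt_trans; [apply im_le_Cmod|].
  apply K. rewrite Cmod_vertical. exact Ht.
Qed.

Lemma ex_RInt_horizontal g a b c d : a <= b ->
  (forall x, a <= x <= b -> ccont g (x, c) /\ ccont g (x, d)) ->
  ex_RInt (fun x => Re (g (x, c)) - Re (g (x, d))) a b.
Proof.
  intros Hab H. apply (ex_RInt_continuous (V := R_CompleteNormedModule)).
  rewrite Rmin_left, Rmax_right by lra. intros x Hx. destruct (H x Hx).
  apply (continuous_minus (V := R_NormedModule)); apply ccont_horizontal; auto.
Qed.

Lemma ex_RInt_vertical g a b c d : c <= d ->
  (forall y, c <= y <= d -> ccont g (a, y) /\ ccont g (b, y)) ->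
  ex_RInt (fun y => Im (g (a, y)) - Im (g (b, y))) c d.
Proof.
  intros Hab H. apply (ex_RInt_continuous (V := R_CompleteNormedModule)).
  rewrite Rmin_left, Rmax_right by lra. intros x Hx. destruct (H x Hx).
  apply (continuous_minus (V := R_NormedModule)); apply ccont_vertical; auto.
Qed.

Lemma RInt_minus_chain (f g h : R -> R) (a b : R) :
  ex_RInt (fun t => f t - g t) a b -> ex_RInt (fun t => g t - h t) a b ->
  RInt (fun t => f t - h t) a b
  = RInt (fun t => f t - g t) a b + RInt (fun t => g t - h t) a b.
Proof.
  intros H1 H2. symmetry.
  etransitivity; [symmetry; apply (RInt_plus (V := R_CompleteNormedModule)); assumption|].
  apply RInt_ext. intros t _. unfold plus; simpl. ring.
Qed.

Lemma circulation_split_x g a m b c d : a <= m <= b -> c <= d ->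
  (forall x, a <= x <= b -> ccont g (x, c) /\ ccont g (x, d)) ->
  (forall y, c <= y <= d -> ccont g (a, y) /\ ccont g (m, y) /\ ccont g (b, y)) ->
  circulation g a b c d = circulation g a m c d + circulation g m b c d.
Proof.
  intros Hm Hcd Hh Hv. unfold circulation.
  rewrite <- (RInt_Chasles (V := R_CompleteNormedModule) _ a m b).
  2, 3: apply ex_RInt_horizontal; [lra|]; intros; apply Hh; lra.
  rewrite (RInt_minus_chain (fun y => Im (g (a, y))) (fun y => Im (g (m, y)))).
  2, 3: apply ex_RInt_vertical; [lra|]; intros y Hy; destruct (Hv y Hy) as [? [? ?]]; auto.
  unfold plus; simpl. ring.
Qed.

Lemma circulation_split_y g a b c m d : a <= b -> c <= m <= d ->
  (forall x, a <= x <= b -> ccont g (x, c) /\ ccont g (x, m) /\ ccont g (x, d)) ->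
  (forall y, c <= y <= d -> ccont g (a, y) /\ ccont g (b, y)) ->
  circulation g a b c d = circulation g a b c m + circulation g a b m d.
Proof.
  intros Hab Hm Hh Hv. unfold circulation.
  rewrite <- (RInt_Chasles (V := R_CompleteNormedModule) (fun y => Im (g (a, y)) - Im (g (b, y))) c m d).
  2, 3: apply ex_RInt_vertical; [lra|]; intros; apply Hv; lra.
  rewrite (RInt_minus_chain (fun x => Re (g (x, c))) (fun x => Re (g (x, m)))).
  2, 3: apply ex_RInt_horizontal; [lra|]; intros y Hy; destruct (Hh y Hy) as [? [? ?]]; auto.
  unfold plus; simpl. ring.
Qed.

Lemma RInt_near_const (f : R -> R) (a b k e : R) : a <= b -> ex_RInt f a b ->
  (forall t, a <= t <= b -> Rabs (f t - k) <= e) ->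
  Rabs (RInt f a b - (b - a) * k) <= (b - a) * e.
Proof.
  intros Hab Hf H.
  replace (RInt f a b - (b - a) * k) with (RInt (fun t => f t - k) a b).
  - apply abs_RInt_le_const; auto.
    apply (ex_RInt_minus (V := R_CompleteNormedModule)); auto. apply ex_RInt_const.
  - etransitivity; [apply (RInt_minus (V := R_CompleteNormedModule)); auto; apply ex_RInt_const|].
    rewrite RInt_const. reflexivity.
Qed.

Lemma Cmod_le_sum (x y px py : R) : Cmod ((x, y) - (px, py))%C <= Rabs (x - px) + Rabs (y - py).
Proof.
  replace ((x, y) - (px, py))%C with (((x, y) - (px, y)) + ((px, y) - (px, py)))%C by ring.
  eapply Rle_trans; [apply Cmod_triangle|].
  rewrite Cmod_horizontal, Cmod_vertical. lra.
Qed.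

(** The circulation of an affine function vanishes, as the two sides of the
    rectangle contribute opposite multiples of its area. The error of the
    linear approximation is at most [eps] times the diameter, and it is
    integrated over the perimeter. *)
Lemma circulation_local g px py l : cderive g (px, py) l ->
  forall eps, 0 < eps -> exists delta, 0 < delta /\
  forall a b c d, a <= px <= b -> c <= py <= d -> (b - a) + (d - c) < delta ->
  (forall x y, a <= x <= b -> c <= y <= d -> ccont g (x, y)) ->
  Rabs (circulation g a b c d) <= eps * ((b - a) + (d - c)) ^ 2.
Proof.
  intros Hg eps Heps. destruct (Hg (eps / 2)) as [delta [Hd H]]; [lra|].
  exists delta; split; auto. intros a b c d Hx Hy Hs Hc.
  set (L := (b - a) + (d - c)) in *.
  assert (HE : forall x y, a <= x <= b -> c <= y <= d ->
    Cmod (g (x, y) - g (px, py) - l * ((x, y) - (px, py)))%C <= eps / 2 * L).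
  { intros x y Hx' Hy'.
    assert (Hl : Cmod ((x, y) - (px, py))%C <= L).
    { eapply Rle_trans; [apply Cmod_le_sum|].
      unfold L. apply Rplus_le_compat; apply Rabs_le; lra. }
    eapply Rle_trans; [apply H; lra|]. apply Rmult_le_compat_l; lra. }
  assert (H1 : Rabs (RInt (fun x => Re (g (x, c)) - Re (g (x, d))) a b - (b - a) * (Im l * (d - c)))
     <= (b - a) * (eps * L)).
  { apply RInt_near_const; [lra| apply ex_RInt_horizontal; [lra|] |].
    - intros x Hx'; split; apply Hc; lra.
    - intros x Hx'.
      pose proof (HE x c ltac:(lra) ltac:(lra)) as E1.
      pose proof (HE x d ltac:(lra) ltac:(lra)) as E2.
      replace (Re (g (x, c)) - Re (g (x, d)) - Im l * (d - c))
        with (Re ((g (x, c) - g (px, py) - l * ((x, c) - (px, py)))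
              - (g (x, d) - g (px, py) - l * ((x, d) - (px, py))))%C)
        by (unfold Cminus, Cmult, Cplus, Copp, Re, Im; simpl; ring).
      eapply Rle_trans; [apply re_le_Cmod|]. unfold Cminus at 1.
      eapply Rle_trans; [apply Cmod_triangle|]. rewrite Cmod_opp. lra. }
  assert (H2 : Rabs (RInt (fun y => Im (g (a, y)) - Im (g (b, y))) c d - (d - c) * (Im l * (a - b)))
     <= (d - c) * (eps * L)).
  { apply RInt_near_const; [lra| apply ex_RInt_vertical; [lra|] |].
    - intros x Hx'; split; apply Hc; lra.
    - intros y Hy'.
      pose proof (HE a y ltac:(lra) ltac:(lra)) as E1.
      pose proof (HE b y ltac:(lra) ltac:(lra)) as E2.
      replace (Im (g (a, y)) - Im (g (b, y)) - Im l * (a - b))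
        with (Im ((g (a, y) - g (px, py) - l * ((a, y) - (px, py)))
              - (g (b, y) - g (px, py) - l * ((b, y) - (px, py))))%C)
        by (unfold Cminus, Cmult, Cplus, Copp, Re, Im; simpl; ring).
      eapply Rle_trans; [apply im_le_Cmod|]. unfold Cminus at 1.
      eapply Rle_trans; [apply Cmod_triangle|]. rewrite Cmod_opp. lra. }
  unfold circulation.
  match goal with |- Rabs (?A + ?B) <= _ =>
    replace (A + B) with ((A - (b - a) * (Im l * (d - c))) + (B - (d - c) * (Im l * (a - b)))) by ring end.
  eapply Rle_trans; [apply Rabs_triang|].
  replace (eps * L ^ 2) with ((b - a) * (eps * L) + (d - c) * (eps * L)) by (unfold L; ring).
  lra.
Qed.

Lemma nested_intervals (u v : nat -> R) :
  (forall n, u n <= u (S n)) -> (forall n, v (S n) <= v n) -> (forall n, u n <= v n) ->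
  exists p, forall n, u n <= p <= v n.
Proof.
  intros Hu Hv Huv.
  assert (Hum : forall n k, u n <= u (n + k)%nat).
  { intros n k. induction k; [rewrite Nat.add_0_r; lra|].
    rewrite Nat.add_succ_r. eapply Rle_trans; [exact IHk|apply Hu]. }
  assert (Hvm : forall n k, v (n + k)%nat <= v n).
  { intros n k. induction k; [rewrite Nat.add_0_r; lra|].
    rewrite Nat.add_succ_r. eapply Rle_trans; [apply Hv|exact IHk]. }
  assert (Hmn : forall m n, u m <= v n).
  { intros m n. eapply Rle_trans; [apply (Hum m n)|]. rewrite Nat.add_comm.
    eapply Rle_trans; [apply Huv|]. apply Hvm. }
  destruct (completeness (fun r => exists n, r = u n)) as [p [Hp1 Hp2]].
  - exists (v 0%nat). intros r [n ->]. apply Hmn.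
  - exists (u 0%nat), 0%nat; auto.
  - exists p. intros n. split.
    + apply Hp1. exists n; auto.
    + apply Hp2. intros r [m ->]. apply Hmn.
Qed.

(** The step of the bisection: the circulation is additive, so one quarter
    carries at least a quarter of it. *)
Lemma circulation_quarter g a m b c k d E : a <= m <= b -> c <= k <= d ->
  (forall x y, a <= x <= b -> c <= y <= d -> ccont g (x, y)) ->
  4 * E < Rabs (circulation g a b c d) ->
  E < Rabs (circulation g a m c k) \/ E < Rabs (circulation g m b c k) \/
  E < Rabs (circulation g a m k d) \/ E < Rabs (circulation g m b k d).
Proof.
  intros Hm Hk Hc H.
  rewrite (circulation_split_x g a m b c d) in H by (try lra; intros; repeat split; apply Hc; lra).
  rewrite (circulation_split_y g a m c k d) in H by (try lra; intros; repeat split; apply Hc; lra).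
  rewrite (circulation_split_y g m b c k d) in H by (try lra; intros; repeat split; apply Hc; lra).
  apply NNPP. intros Hn.
  apply not_or_and in Hn as [N1 Hn]. apply not_or_and in Hn as [N2 Hn].
  apply not_or_and in Hn as [N3 N4].
  apply Rnot_lt_le in N1, N2, N3, N4.
  apply (Rlt_not_le _ _ H).
  eapply Rle_trans; [apply Rabs_triang|].
  pose proof (Rabs_triang (circulation g a m c k) (circulation g a m k d)).
  pose proof (Rabs_triang (circulation g m b c k) (circulation g m b k d)).
  lra.
Qed.

(** If the circulation is not 0, it exceeds [eps * L ^ 2], [L] being half the
    perimeter. Passing to a well chosen quarter divides [L ^ 2] by 4 and the
    circulation by at most 4, so the inequality survives along a nested sequence
    of rectangles; at their common point it contradicts [circulation_local]. *)
Lemma goursat g a b c d : a <= b -> c <= d ->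
  (forall x y, a <= x <= b -> c <= y <= d -> exists l, cderive g (x, y) l) ->
  circulation g a b c d = 0.
Proof.
  intros Hab Hcd Hg.
  assert (Hc : forall x y, a <= x <= b -> c <= y <= d -> ccont g (x, y)).
  { intros x y Hx Hy. destruct (Hg x y Hx Hy) as [l Hl]. eapply cderive_ccont; eauto. }
  destruct (Req_dec (circulation g a b c d) 0) as [|Hne]; [assumption|exfalso].
  apply Rabs_pos_lt in Hne.
  set (W := b - a). set (H := d - c). set (L := W + H).
  set (eps := Rabs (circulation g a b c d) / (L ^ 2 + 1)).
  pose proof (pow2_ge_0 L) as HL.
  assert (Heps : 0 < eps) by (apply Rdiv_lt_0_compat; lra).
  set (h := fun n : nat => (1 / 2) ^ n).
  assert (Hh : forall n, 0 < h n) by (intros; apply pow_lt; lra).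
  assert (HhS : forall n, h (S n) = h n / 2) by (intros; unfold h; simpl; lra).
  (* [p] is the lower left corner of a rectangle of the [n]-th generation whose
     circulation is still too large *)
  set (good := fun n (p : R * R) =>
    a <= fst p /\ fst p + W * h n <= b /\ c <= snd p /\ snd p + H * h n <= d /\
    eps * (L * h n) ^ 2 <
      Rabs (circulation g (fst p) (fst p + W * h n) (snd p) (snd p + H * h n))).
  assert (Hstep : forall n p, exists p', good n p -> good (S n) p' /\
    fst p <= fst p' /\ fst p' + W * h (S n) <= fst p + W * h n /\
    snd p <= snd p' /\ snd p' + H * h (S n) <= snd p + H * h n).
  { intros n p. destruct (classic (good n p)) as [G|G].
    2: { exists p; intros; contradiction. }
    destruct p as [x y]. destruct G as [G1 [G2 [G3 [G4 G5]]]]. cbn [fst snd] in G1, G2, G3, G4, G5.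
    pose proof (Hh n) as Hn.
    assert (HW : 0 <= W * h (S n)) by (rewrite HhS; unfold W; apply Rmult_le_pos; lra).
    assert (HH : 0 <= H * h (S n)) by (rewrite HhS; unfold H; apply Rmult_le_pos; lra).
    assert (EW : x + W * h n = x + W * h (S n) + W * h (S n)) by (rewrite HhS; lra).
    assert (EH : y + H * h n = y + H * h (S n) + H * h (S n)) by (rewrite HhS; lra).
    replace (eps * (L * h n) ^ 2) with (4 * (eps * (L * h (S n)) ^ 2)) in G5 by (rewrite HhS; field).
    apply (circulation_quarter g _ (x + W * h (S n)) _ _ (y + H * h (S n))) in G5.
    2, 3: lra.
    2: intros; apply Hc; lra.
    rewrite EW, EH in G5. unfold good.
    destruct G5 as [G5|[G5|[G5|G5]]];
    [ exists (x, y) | exists (x + W * h (S n), y) | exists (x, y + H * h (S n))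
    | exists (x + W * h (S n), y + H * h (S n)) ]; intros _; cbn [fst snd];
    repeat split; try lra; exact G5. }
  (* choosing a next corner for every pair, good or not, allows a plain recursion *)
  set (next := fun n p => proj1_sig (constructive_indefinite_description _ (Hstep n p))).
  assert (Hnext : forall n p, good n p -> good (S n) (next n p) /\
    fst p <= fst (next n p) /\ fst (next n p) + W * h (S n) <= fst p + W * h n /\
    snd p <= snd (next n p) /\ snd (next n p) + H * h (S n) <= snd p + H * h n).
  { intros n p. unfold next. apply proj2_sig. }
  set (u := fix u (n : nat) : R * R := match n with O => (a, c) | S m => next m (u m) end).
  assert (Hgood : forall n, good n (u n)).
  { induction n; [|apply Hnext; exact IHn].
    unfold good, u, h; simpl.
    replace (a + W * 1) with b by (unfold W; ring).
    replace (c + H * 1) with d by (unfold H; ring).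
    repeat split; try lra.
    apply Rlt_le_trans with (eps * (L ^ 2 + 1)); [simpl; nra|].
    right. unfold eps. field. simpl; simpl in HL; lra. }
  assert (Hmono : forall n, fst (u n) <= fst (u (S n)) /\
     fst (u (S n)) + W * h (S n) <= fst (u n) + W * h n /\
     snd (u n) <= snd (u (S n)) /\ snd (u (S n)) + H * h (S n) <= snd (u n) + H * h n).
  { intros n. apply (Hnext n (u n) (Hgood n)). }
  assert (HW : 0 <= W) by (unfold W; lra). assert (HH : 0 <= H) by (unfold H; lra).
  destruct (nested_intervals (fun n => fst (u n)) (fun n => fst (u n) + W * h n)) as [px Hpx];
    try (intros n; apply Hmono).
  { intros n. pose proof (Rmult_le_pos _ _ HW (Rlt_le _ _ (Hh n))). lra. }
  destruct (nested_intervals (fun n => snd (u n)) (fun n => snd (u n) + H * h n)) as [py Hpy];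
    try (intros n; apply Hmono).
  { intros n. pose proof (Rmult_le_pos _ _ HH (Rlt_le _ _ (Hh n))). lra. }
  destruct (Hg px py) as [l Hl].
  { destruct (Hgood 0%nat) as [A1 [A2 _]]. pose proof (Hpx 0%nat). lra. }
  { destruct (Hgood 0%nat) as [_ [_ [A1 [A2 _]]]]. pose proof (Hpy 0%nat). lra. }
  destruct (circulation_local g px py l Hl eps Heps) as [delta [Hd Hloc]].
  assert (HL1 : 0 < L + 1) by (unfold L; lra).
  destruct (pow_lt_1_zero (1 / 2) ltac:(rewrite Rabs_pos_eq; lra) (delta / (L + 1))) as [N HN].
  { apply Rdiv_lt_0_compat; lra. }
  specialize (HN N (Nat.le_refl N)). change ((1 / 2) ^ N) with (h N) in HN.
  pose proof (Hh N) as HhN. rewrite Rabs_pos_eq in HN by lra.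
  destruct (Hgood N) as [A1 [A2 [A3 [A4 A5]]]].
  apply (Rlt_not_le _ _ A5).
  replace (L * h N) with ((fst (u N) + W * h N - fst (u N)) + (snd (u N) + H * h N - snd (u N)))
    by (unfold L; ring).
  apply Hloc; [apply Hpx | apply Hpy | |].
  - replace ((fst (u N) + W * h N - fst (u N)) + (snd (u N) + H * h N - snd (u N))) with (L * h N)
      by (unfold L; ring).
    apply Rmult_lt_compat_l with (r := L + 1) in HN; [|lra].
    replace ((L + 1) * (delta / (L + 1))) with delta in HN by (field; lra). lra.
  - intros x y Hx Hy. apply Hc; lra.
Qed.

(** * Cauchy's estimate on the strip *)

(** The large rectangle consists of the small square and of four rectangles that
    avoid the origin, to which [goursat] applies. *)
Lemma circulation_around_origin g s T r : 0 < r -> r <= s -> r <= T ->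
  (forall x y, -s <= x <= s -> -T <= y <= T -> x <> 0 \/ y <> 0 ->
     exists l, cderive g (x, y) l) ->
  circulation g (-s) s (-T) T = circulation g (-r) r (-r) r.
Proof.
  intros Hr Hrs HrT Hg.
  assert (Hc : forall x y, -s <= x <= s -> -T <= y <= T -> x <> 0 \/ y <> 0 -> ccont g (x, y)).
  { intros x y Hx Hy Hn. destruct (Hg x y Hx Hy Hn) as [l Hl]. eapply cderive_ccont; eauto. }
  rewrite (circulation_split_x g (-s) (-r) s) by
    (try lra; intros; repeat split; apply Hc; lra).
  rewrite (circulation_split_x g (-r) r s) by
    (try lra; intros; repeat split; apply Hc; lra).
  rewrite (circulation_split_y g (-r) r (-T) (-r) T) by
    (try lra; intros; repeat split; apply Hc; lra).
  rewrite (circulation_split_y g (-r) r (-r) r T) by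
    (try lra; intros; repeat split; apply Hc; lra).
  rewrite (goursat g (-s) (-r)) by (try lra; intros; apply Hg; lra).
  rewrite (goursat g r s) by (try lra; intros; apply Hg; lra).
  rewrite (goursat g (-r) r (-T) (-r)) by (try lra; intros; apply Hg; lra).
  rewrite (goursat g (-r) r r T) by (try lra; intros; apply Hg; lra).
  ring.
Qed.

Lemma RInt_ge_const (f : R -> R) (a b k : R) : a <= b -> ex_RInt f a b ->
  (forall t, a <= t <= b -> k <= f t) -> (b - a) * k <= RInt f a b.
Proof.
  intros Hab Hf H.
  replace ((b - a) * k) with (RInt (fun _ => k) a b) by (rewrite RInt_const; reflexivity).
  apply RInt_le; auto; [apply ex_RInt_const|]. intros; apply H; lra.
Qed.

(** Near a simple pole with residue [- i b] the function [g] is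
    [- (b y + i b x) / (x ^ 2 + y ^ 2)] up to the error. *)
Lemma pole_part (g : C -> C) (b e x y : R) : (x, y) <> RtoC 0 ->
  Cmod (g (x, y) * (x, y) - - Ci * RtoC b) <= e ->
  Rabs (Re (g (x, y)) + b * y / (x ^ 2 + y ^ 2)) <= e / sqrt (x ^ 2 + y ^ 2) /\
  Rabs (Im (g (x, y)) + b * x / (x ^ 2 + y ^ 2)) <= e / sqrt (x ^ 2 + y ^ 2).
Proof.
  intros Hn H.
  assert (Hm : 0 < sqrt (x ^ 2 + y ^ 2)) by exact (proj1 (Cmod_gt_0 (x, y)) Hn).
  assert (Hp : 0 < x ^ 2 + y ^ 2).
  { destruct (Rle_or_lt (x ^ 2 + y ^ 2) 0) as [Hl|]; auto.
    rewrite sqrt_neg_0 in Hm; lra. }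
  set (k := (- (b * y / (x ^ 2 + y ^ 2)), - (b * x / (x ^ 2 + y ^ 2))) : C).
  assert (Hk : (- Ci * RtoC b)%C = (k * (x, y))%C).
  { unfold k, Ci, RtoC, Cmult, Copp; simpl fst; simpl snd. f_equal; field; lra. }
  rewrite Hk in H.
  replace (g (x, y) * (x, y) - k * (x, y))%C with ((g (x, y) - k) * (x, y))%C in H by ring.
  rewrite Cmod_mult in H. change (Cmod (x, y)) with (sqrt (x ^ 2 + y ^ 2)) in H.
  assert (H' : Cmod (g (x, y) - k) <= e / sqrt (x ^ 2 + y ^ 2)).
  { apply Rmult_le_reg_r with (1 := Hm). eapply Rle_trans; [exact H|]. right. field. lra. }
  split.
  - replace (Re (g (x, y)) + b * y / (x ^ 2 + y ^ 2)) with (Re (g (x, y) - k)%C)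
      by (rewrite Re_minus; unfold k, Re; simpl; ring).
    eapply Rle_trans; [apply re_le_Cmod|exact H'].
  - replace (Im (g (x, y)) + b * x / (x ^ 2 + y ^ 2)) with (Im (g (x, y) - k)%C)
      by (rewrite Im_minus; unfold k, Im; simpl; ring).
    eapply Rle_trans; [apply im_le_Cmod|exact H'].
Qed.

(** The exact circulation of [- i b / z] is [2 pi b]. The crude bound [4 b] comes
    from [r / (t ^ 2 + r ^ 2) >= 1 / (2 r)] on each side of the square, where all
    four sides contribute with the same sign. *)
Lemma circulation_small_square (g : C -> C) (b e r : R) : 0 < r -> 0 <= b -> 0 <= e ->
  (forall x y, -r <= x <= r -> -r <= y <= r -> x <> 0 \/ y <> 0 ->
     ccont g (x, y) /\ Cmod (g (x, y) * (x, y) - - Ci * RtoC b) <= e) ->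
  4 * b - 8 * e <= circulation g (-r) r (-r) r.
Proof.
  intros Hr Hb He Hg.
  assert (Hne : forall x y, x <> 0 \/ y <> 0 -> (x, y) <> RtoC 0).
  { intros x y Hxy E. injection E. intros. lra. }
  assert (Hpp : forall x y, -r <= x <= r -> -r <= y <= r -> x ^ 2 = r ^ 2 \/ y ^ 2 = r ^ 2 ->
     Rabs (Re (g (x, y)) + b * y / (x ^ 2 + y ^ 2)) <= e / r /\
     Rabs (Im (g (x, y)) + b * x / (x ^ 2 + y ^ 2)) <= e / r).
  { intros x y Hx Hy Hxy.
    assert (Hn : x <> 0 \/ y <> 0).
    { destruct Hxy; [left|right]; intros ->; nra. }
    destruct (pole_part g b e x y (Hne _ _ Hn) (proj2 (Hg x y Hx Hy Hn))) as [P1 P2].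
    assert (Hs : e / sqrt (x ^ 2 + y ^ 2) <= e / r).
    { apply Rmult_le_compat_l; auto. apply Rinv_le_contravar; auto.
      rewrite <- (sqrt_pow2 r) by lra. apply sqrt_le_1_alt. nra. }
    split; lra. }
  assert (Hq : forall t, -r <= t <= r -> b / (2 * r) <= b * r / (t ^ 2 + r ^ 2)).
  { intros t Ht. unfold Rdiv. rewrite Rmult_assoc. apply Rmult_le_compat_l; auto.
    apply Rmult_le_reg_r with (t ^ 2 + r ^ 2); [nra|].
    rewrite Rmult_assoc, Rinv_l by nra.
    apply Rmult_le_reg_l with (2 * r); [lra|]. rewrite <- Rmult_assoc, Rinv_r by lra. nra. }
  unfold circulation.
  assert (I1 : (r - - r) * (b / r - 2 * (e / r)) <= RInt (fun x => Re (g (x, - r)) - Re (g (x, r))) (- r) r).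
  { apply RInt_ge_const; [lra| |].
    - apply ex_RInt_horizontal; [lra|]. intros; split; apply Hg; lra.
    - intros t Ht.
      destruct (Hpp t (-r) Ht ltac:(lra) ltac:(right; ring)) as [P1 _].
      destruct (Hpp t r Ht ltac:(lra) ltac:(right; ring)) as [P2 _].
      apply Rabs_le_between in P1, P2.
      specialize (Hq t Ht).
      replace (b * - r / (t ^ 2 + (- r) ^ 2)) with (- (b * r / (t ^ 2 + r ^ 2))) in P1 by (field; nra).
      replace (b / r) with (b / (2 * r) + b / (2 * r)) by (field; lra). lra. }
  assert (I2 : (r - - r) * (b / r - 2 * (e / r)) <= RInt (fun y => Im (g (- r, y)) - Im (g (r, y))) (- r) r).
  { apply RInt_ge_const; [lra| |].
    - apply ex_RInt_vertical; [lra|]. intros; split; apply Hg; lra.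
    - intros t Ht.
      destruct (Hpp (-r) t ltac:(lra) Ht ltac:(left; ring)) as [_ P1].
      destruct (Hpp r t ltac:(lra) Ht ltac:(left; ring)) as [_ P2].
      apply Rabs_le_between in P1, P2.
      specialize (Hq t Ht).
      replace (b * - r / ((- r) ^ 2 + t ^ 2)) with (- (b * r / (t ^ 2 + r ^ 2))) in P1 by (field; nra).
      replace (b * r / (r ^ 2 + t ^ 2)) with (b * r / (t ^ 2 + r ^ 2)) in P2 by (field; nra).
      replace (b / r) with (b / (2 * r) + b / (2 * r)) by (field; lra). lra. }
  replace ((r - - r) * (b / r - 2 * (e / r))) with (2 * b - 4 * e) in I1, I2 by (field; lra).
  lra.
Qed.

(** Compactness of [[-T, T]]: a property that holds to the right of each of its
    points on some neighbourhood holds on a strip of fixed width. *)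
Lemma compact_uniform (P : R -> R -> Prop) (T : R) :
  (forall y, -T <= y <= T -> exists delta, 0 < delta /\
     forall s y', 0 <= s < delta -> Rabs (y' - y) < delta -> P s y') ->
  exists d, 0 < d /\ forall s y, 0 <= s < d -> -T <= y <= T -> P s y.
Proof.
  intros H.
  assert (H' : forall y, exists delta : posreal, -T <= y <= T ->
     forall s y', 0 <= s < delta -> Rabs (y' - y) < delta -> P s y').
  { intros y. destruct (classic (-T <= y <= T)) as [Hy|Hy].
    - destruct (H y Hy) as [d [Hd K]]. exists (mkposreal d Hd). intros _. exact K.
    - exists (mkposreal 1 Rlt_0_1). tauto. }
  set (dl := fun y => proj1_sig (constructive_indefinite_description _ (H' y))).
  assert (Hdl : forall y, -T <= y <= T ->
     forall s y', 0 <= s < dl y -> Rabs (y' - y) < dl y -> P s y').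
  { intros y. unfold dl. apply proj2_sig. }
  destruct (compactness_value_2d (-T) T 0 0 (fun u _ => dl u)) as [d Hd].
  exists d; split; [apply cond_pos|].
  intros s y Hs Hy. apply NNPP. intros Hn.
  apply (Hd y 0 Hy ltac:(lra)). intros [u [v [Hu [_ [Hyu [_ Hdu]]]]]].
  apply Hn, (Hdl u Hu); lra.
Qed.

Definition strip_continuous (f : C -> C) : Prop :=
  forall z, strip z -> forall eps, 0 < eps -> exists delta, 0 < delta /\
    forall w, strip w -> Cmod (w - z) < delta -> Cmod (f w - f z) < eps.

Record bounded_analytic (f : C -> C) : Prop := {
  ba_bounded : exists M0, forall z, strip z -> Cmod (f z) <= M0;
  ba_continuous : strip_continuous f;
  ba_analytic : forall z, 0 < Re z < 1 -> exists l, cderive f z l }.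

(** Contours have to stay inside the open strip, where [f] is differentiable;
    by compactness the bound on the boundary extends, up to [eta], to the nearby
    parts of height [T]. *)
Lemma near_boundary f (M eta T : R) : 0 < eta -> strip_continuous f ->
  (forall z, Re z = 0 \/ Re z = 1 -> Cmod (f z) <= M) ->
  exists d, 0 < d /\ forall s y, 0 <= s < d -> -T <= y <= T ->
    s <= 1 -> Cmod (f (s, y)) <= M + eta /\ Cmod (f (1 - s, y)) <= M + eta.
Proof.
  intros Heta Hc HM.
  apply (compact_uniform (fun s y => s <= 1 ->
     Cmod (f (s, y)) <= M + eta /\ Cmod (f (1 - s, y)) <= M + eta)).
  intros y Hy.
  destruct (Hc (0, y) ltac:(unfold strip; simpl; lra) eta Heta) as [d1 [Hd1 K1]].
  destruct (Hc (1, y) ltac:(unfold strip; simpl; lra) eta Heta) as [d2 [Hd2 K2]].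
  pose proof (Rmin_l d1 d2). pose proof (Rmin_r d1 d2).
  exists (Rmin d1 d2 / 2); split; [pose proof (Rmin_pos _ _ Hd1 Hd2); lra|].
  intros s y' Hs Hy' Hs1.
  specialize (K1 (s, y') ltac:(unfold strip; simpl; lra)).
  specialize (K2 (1 - s, y') ltac:(unfold strip; simpl; lra)).
  pose proof (Cmod_le_sum s y' 0 y) as B1.
  pose proof (Cmod_le_sum (1 - s) y' 1 y) as B2.
  replace (s - 0) with s in B1 by ring. replace (1 - s - 1) with (- s) in B2 by ring.
  rewrite Rabs_Ropp in B2. rewrite (Rabs_pos_eq s) in B1, B2 by lra.
  specialize (K1 ltac:(lra)). specialize (K2 ltac:(lra)).
  pose proof (HM (0, y) ltac:(left; reflexivity)). pose proof (HM (1, y) ltac:(right; reflexivity)).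
  split.
  - replace (f (s, y')) with (f (s, y') - f (0, y) + f (0, y))%C by ring.
    eapply Rle_trans; [apply Cmod_triangle|]. lra.
  - replace (f (1 - s, y')) with (f ((1 - s)%R, y') - f (1, y) + f (1, y))%C by ring.
    eapply Rle_trans; [apply Cmod_triangle|]. lra.
Qed.

Lemma RInt_inv_1_sqr (T k : R) : 0 <= T -> 0 <= k ->
  ex_RInt (fun y => k * / (1 + Rsqr y)) (-T) T /\
  RInt (fun y => k * / (1 + Rsqr y)) (-T) T <= k * PI.
Proof.
  intros HT Hk.
  assert (HI : is_RInt (fun y => k * / (1 + Rsqr y)) (-T) T (k * atan T - k * atan (-T))).
  { apply (is_RInt_derive (V := R_CompleteNormedModule) (fun y => k * atan y)).
    - intros x _. apply (is_derive_scal atan). apply is_derive_atan.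
    - intros x _. apply (continuous_scal_r (K := R_AbsRing) (V := R_NormedModule) k (fun y => / (1 + Rsqr y))).
      apply continuous_Rinv_comp.
      + apply (continuous_plus (V := R_NormedModule)); [apply continuous_const|].
        apply (continuous_mult (K := R_AbsRing)); apply continuous_id.
      + pose proof (Rle_0_sqr x). lra. }
  split; [eexists; exact HI|].
  rewrite (is_RInt_unique _ _ _ _ HI).
  pose proof (atan_bound T). rewrite atan_opp. nra.
Qed.

Lemma Cmod_sqr (x y : R) : Cmod (x, y) * Cmod (x, y) = x ^ 2 + y ^ 2.
Proof. apply sqrt_sqrt. simpl; nra. Qed.

(** The hypotheses bound [g z * z ^ 2]. On the horizontal sides this gives
    [M0 / T ^ 2]; on the vertical ones [M / (s ^ 2 + y ^ 2)], which is at most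
    [16 M / (1 + y ^ 2)] because [s >= 1 / 4] and so has a bounded integral. *)
Lemma circulation_large_rectangle g (s T M M0 : R) : 1 / 4 <= s <= 1 / 2 -> 1 <= T -> 0 <= M -> 0 <= M0 ->
  (forall x y, -s <= x <= s -> -T <= y <= T -> x <> 0 \/ y <> 0 -> ccont g (x, y)) ->
  (forall x y, -s <= x <= s -> y = T \/ y = - T -> Cmod (g (x, y) * ((x, y) * (x, y))) <= M0) ->
  (forall x y, x = s \/ x = - s -> -T <= y <= T -> Cmod (g (x, y) * ((x, y) * (x, y))) <= M) ->
  circulation g (-s) s (-T) T <= 2 * M0 / T + 32 * PI * M.
Proof.
  intros Hs HT HM HM0 Hc H0 HB. unfold circulation.
  assert (Hk : forall x y k, 0 < x ^ 2 + y ^ 2 -> Cmod (g (x, y) * ((x, y) * (x, y))) <= k ->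
     Cmod (g (x, y)) <= k / (x ^ 2 + y ^ 2)).
  { intros x y k Hp Hk. rewrite !Cmod_mult, Cmod_sqr in Hk.
    apply Rmult_le_reg_r with (1 := Hp). eapply Rle_trans; [exact Hk|]. right; field; lra. }
  apply Rplus_le_compat.
  - assert (Hh : Rabs (RInt (fun x => Re (g (x, - T)) - Re (g (x, T))) (- s) s) <= (s - - s) * (2 * (M0 / T))).
    { apply abs_RInt_le_const; [lra| apply ex_RInt_horizontal; [lra|]; intros; split; apply Hc; lra |].
      intros x Hx.
      assert (Hb : forall y, y = T \/ y = - T -> Rabs (Re (g (x, y))) <= M0 / T).
      { intros y Hy. eapply Rle_trans; [apply re_le_Cmod|].
        assert (Hyy : y ^ 2 = T ^ 2) by (destruct Hy; subst; ring).
        eapply Rle_trans; [apply (Hk x y M0); [nra|apply H0; auto]|].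
        apply Rmult_le_compat_l; auto. apply Rinv_le_contravar; nra. }
      pose proof (Hb T ltac:(auto)) as B1. pose proof (Hb (-T) ltac:(auto)) as B2.
      unfold Rminus. eapply Rle_trans; [apply Rabs_triang|]. rewrite Rabs_Ropp. lra. }
    eapply Rle_trans; [apply Rle_abs|]. eapply Rle_trans; [exact Hh|].
    assert (0 <= M0 / T) by (apply Rdiv_le_0_compat; lra).
    replace (2 * M0 / T) with (2 * (M0 / T)) by (field; lra). nra.
  - destruct (RInt_inv_1_sqr T (32 * M)) as [E1 E2]; [lra|lra|].
    replace (32 * PI * M) with (32 * M * PI) by ring.
    eapply Rle_trans; [|exact E2].
    apply RInt_le; [lra| |exact E1|].
    + apply ex_RInt_vertical; [lra|]; intros; split; apply Hc; lra.
    + intros y Hy.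
      assert (Hb : forall x, x = s \/ x = - s -> Rabs (Im (g (x, y))) <= 16 * M * / (1 + Rsqr y)).
      { intros x Hx. eapply Rle_trans; [apply im_le_Cmod|].
        assert (Hxx : x ^ 2 = s ^ 2) by (destruct Hx; subst; ring).
        assert (Hp : 0 < x ^ 2 + y ^ 2) by (rewrite Hxx; nra).
        eapply Rle_trans; [apply (Hk x y M Hp); apply HB; [auto|lra]|].
        apply Rmult_le_reg_r with (1 := Hp).
        unfold Rdiv at 1. rewrite Rmult_assoc, Rinv_l, Rmult_1_r by lra.
        unfold Rsqr.
        assert (Hq : 1 <= 16 * / (1 + y * y) * (x ^ 2 + y ^ 2)).
        { apply Rmult_le_reg_r with (1 + y * y); [nra|].
          replace (16 * / (1 + y * y) * (x ^ 2 + y ^ 2) * (1 + y * y)) with (16 * (x ^ 2 + y ^ 2))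
            by (field; nra). rewrite Hxx; nra. }
        replace (16 * M * / (1 + y * y) * (x ^ 2 + y ^ 2))
          with (M * (16 * / (1 + y * y) * (x ^ 2 + y ^ 2))) by ring.
        nra. }
      pose proof (Hb s ltac:(auto)) as B1. pose proof (Hb (-s) ltac:(auto)) as B2.
      apply Rabs_le_between in B1, B2. lra.
Qed.

(** The odd part of [f] about 1/2, with the origin moved there, times [k]. It
    satisfies the same bounds as [f] and has the same derivative, up to [k], but
    vanishes at the centre, so that its quotient by [z ^ 2] has a simple pole. *)
Definition odd_part (k : C) (f : C -> C) (z : C) : C :=
  (k * / 2 * (f (RtoC (1 / 2) + 1 * z) + (- (1)) * f (RtoC (1 / 2) + (- (1)) * z)))%C.

Lemma cderive_odd_part k f z l1 l2 :
  cderive f (RtoC (1 / 2) + 1 * z)%C l1 -> cderive f (RtoC (1 / 2) + (- (1)) * z)%C l2 ->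
  cderive (odd_part k f) z (k * / 2 * (l1 + l2))%C.
Proof.
  intros H1 H2.
  apply cderive_comp_affine in H1. apply cderive_comp_affine in H2.
  pose proof (cderive_mult _ _ _ _ _ (cderive_const (- (1))%C z) H2) as H3.
  pose proof (cderive_plus _ _ _ _ _ H1 H3) as H4.
  pose proof (cderive_mult _ _ _ _ _ (cderive_const (k * / 2)%C z) H4) as H5.
  match type of H5 with cderive _ _ ?m => replace (k * / 2 * (l1 + l2))%C with m by ring end.
  exact H5.
Qed.

Lemma Cmod_odd_part k f x y : Cmod k = 1 ->
  Cmod (odd_part k f (x, y)) <= (Cmod (f (1 / 2 + x, y)) + Cmod (f (1 / 2 - x, - y))) / 2.
Proof.
  intros Hk. unfold odd_part.
  replace (RtoC (1 / 2) + 1 * (x, y))%C with (1 / 2 + x, y)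
    by (unfold RtoC, Cplus, Cmult; simpl; f_equal; ring).
  replace (RtoC (1 / 2) + - (1) * (x, y))%C with (1 / 2 - x, - y)
    by (unfold RtoC, Cplus, Cmult, Copp; simpl; f_equal; ring).
  rewrite !Cmod_mult, Hk, Cmod_inv by (intros E; apply RtoC_inj in E; lra).
  rewrite (Cmod_R 2), Rabs_pos_eq by lra.
  pose proof (Cmod_triangle (f (1 / 2 + x, y)) (- (1) * f (1 / 2 - x, - y))) as Ht.
  rewrite Cmod_mult, Cmod_m1 in Ht. lra.
Qed.

Lemma Cminus_0_r (z : C) : (z - 0)%C = z.
Proof. ring. Qed.

(** The circulation of [h z / z ^ 2], [h] an odd part, is the same around the
    small square, where it is at least about [4 |l|], and around the large
    rectangle, where it is at most about [32 pi M]. *)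
Lemma analytic_derivative_bound f M l : bounded_analytic f ->
  (forall z, Re z = 0 \/ Re z = 1 -> Cmod (f z) <= M) ->
  cderive f (RtoC (1 / 2)) l -> Cmod l <= 8 * PI * M.
Proof.
  intros [[M0 HM0] Hcont Hana] HM Hl.
  assert (HMp : 0 <= M).
  { eapply Rle_trans; [apply Cmod_ge_0|apply (HM 0%C); left; reflexivity]. }
  assert (HM0p : 0 <= M0).
  { eapply Rle_trans; [apply Cmod_ge_0|apply (HM0 0%C); unfold strip; simpl; lra]. }
  pose proof PI_RGT_0 as HPI.
  destruct (Ceq_dec l 0%C) as [->|Hl0].
  { rewrite Cmod_0. nra. }
  set (b := Cmod l). assert (Hb : 0 < b) by (apply Cmod_gt_0; auto).
  (* the unimodular factor that makes the residue equal to [- i |l|], whose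
     contribution to the contour integral is real and positive *)
  set (k := (- Ci * RtoC b / l)%C).
  assert (Hk : Cmod k = 1).
  { unfold k. rewrite Cmod_div, Cmod_mult, Cmod_opp, Cmod_Ci, Cmod_R, Rabs_pos_eq by (auto; lra).
    unfold b in *. field. lra. }
  set (h := odd_part k f).
  set (g := fun z : C => (h z * (/ z * / z))%C).
  assert (Hh0 : h 0%C = 0%C).
  { unfold h, odd_part. replace (- (1) * 0)%C with (1 * 0)%C by ring. ring. }
  assert (Hdh0 : cderive h 0%C (- Ci * RtoC b)%C).
  { replace (- Ci * RtoC b)%C with (k * / 2 * (l + l))%C.
    - apply cderive_odd_part.
      + replace (RtoC (1 / 2) + 1 * 0)%C with (RtoC (1 / 2)) by ring. exact Hl.
      + replace (RtoC (1 / 2) + - (1) * 0)%C with (RtoC (1 / 2)) by ring. exact Hl.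
      - unfold k. field. exact Hl0. }
  assert (Hdg : forall x y, -1 / 2 < x < 1 / 2 -> x <> 0 \/ y <> 0 -> exists m, cderive g (x, y) m).
  { intros x y Hx Hn.
    destruct (Hana (RtoC (1 / 2) + 1 * (x, y))%C) as [l1 Hl1]; [simpl; lra|].
    destruct (Hana (RtoC (1 / 2) + - (1) * (x, y))%C) as [l2 Hl2]; [simpl; lra|].
    assert (Hxy : (x, y) <> RtoC 0) by (intros E; injection E; intros; lra).
    pose proof (cderive_mult _ _ _ _ _ (cderive_id (x, y)) (cderive_id (x, y))) as Hsq.
    pose proof (cderive_inv _ Hxy) as Hinv.
    pose proof (cderive_mult _ _ _ _ _ Hinv Hinv) as Hinv2.
    eexists.
    apply cderive_mult; [apply cderive_odd_part; eassumption|]. exact Hinv2. }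
  assert (Hgh : forall z : C, z <> RtoC 0 -> (g z * (z * z))%C = h z).
  { intros z Hz. unfold g. field. exact Hz. }
  assert (Hmain : forall e, 0 < e -> 4 * b - 8 * e <= e + 32 * PI * (M + e)).
  { intros e He.
    (* high enough for the horizontal sides to contribute at most [e] *)
    set (T := 1 + 2 * M0 / e).
    assert (HT : 1 <= T).
    { assert (0 <= 2 * M0 / e) by (apply Rdiv_le_0_compat; lra). unfold T; lra. }
    destruct (near_boundary f M e T He Hcont HM) as [d [Hd Hnb]].
    set (s := 1 / 2 - Rmin (d / 2) (1 / 4)).
    assert (Hs : 1 / 4 <= s < 1 / 2).
    { pose proof (Rmin_r (d / 2) (1 / 4)).
      assert (0 < Rmin (d / 2) (1 / 4)) by (apply Rmin_pos; lra). unfold s; lra. }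
    assert (Hsd : 1 / 2 - s < d).
    { pose proof (Rmin_l (d / 2) (1 / 4)). unfold s; lra. }
    destruct (Hdh0 e He) as [delta [Hdelta Hloc]].
    set (r := Rmin (delta / 3) (1 / 4)).
    assert (Hr : 0 < r) by (apply Rmin_pos; lra).
    assert (Hr1 : r <= 1 / 4) by apply Rmin_r.
    assert (Hr2 : r <= delta / 3) by apply Rmin_l.
    assert (Hne : forall x y, x <> 0 \/ y <> 0 -> (x, y) <> RtoC 0).
    { intros x y Hn E. injection E. intros. lra. }
    assert (Hcg : forall x y, - s <= x <= s -> x <> 0 \/ y <> 0 -> ccont g (x, y)).
    { intros x y Hx Hn. destruct (Hdg x y) as [m Hm]; [lra|auto|]. eapply cderive_ccont; eauto. }
    apply Rle_trans with (circulation g (- r) r (- r) r).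
    - apply circulation_small_square; try lra.
      intros x y Hx Hy Hn. split; [apply Hcg; [lra|auto]|].
      pose proof (Hne x y Hn) as Hz.
      assert (Hzm : 0 < Cmod (x, y)) by (apply Cmod_gt_0; auto).
      assert (Hzd : Cmod ((x, y) - 0)%C < delta).
      { eapply Rle_lt_trans; [apply Cmod_le_sum|].
        replace (x - 0) with x by ring. replace (y - 0) with y by ring.
        assert (Rabs x <= r) by (apply Rabs_le; lra).
        assert (Rabs y <= r) by (apply Rabs_le; lra). lra. }
      specialize (Hloc _ Hzd). rewrite Hh0 in Hloc.
      rewrite (Cminus_0_r (x, y)) in Hloc.
      apply Rmult_le_reg_r with (1 := Hzm). rewrite <- Cmod_mult.
      replace ((g (x, y) * (x, y) - - Ci * b) * (x, y))%C
        with (h (x, y) - 0 - - Ci * b * (x, y))%C; [exact Hloc|].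
      rewrite <- (Hgh _ Hz). ring.
    - rewrite <- (circulation_around_origin g s T r); try lra.
      2: { intros x y Hx Hy Hn. apply Hdg; [lra|auto]. }
      eapply Rle_trans; [apply (circulation_large_rectangle g s T (M + e) M0); try lra|].
      + intros x y Hx Hy Hn. apply Hcg; auto.
      + intros x y Hx Hy.
        rewrite Hgh by (apply Hne; lra).
        eapply Rle_trans; [apply Cmod_odd_part; exact Hk|].
        pose proof (HM0 (1 / 2 + x, y) ltac:(unfold strip; simpl; lra)).
        pose proof (HM0 (1 / 2 - x, - y) ltac:(unfold strip; simpl; lra)). lra.
      + intros x y Hx Hy.
        rewrite Hgh by (apply Hne; lra).
        eapply Rle_trans; [apply Cmod_odd_part; exact Hk|].
        destruct (Hnb (1 / 2 - s) y ltac:(lra) ltac:(lra) ltac:(lra)) as [A1 A2].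
        destruct (Hnb (1 / 2 - s) (- y) ltac:(lra) ltac:(lra) ltac:(lra)) as [A3 A4].
        replace (1 - (1 / 2 - s)) with (1 / 2 + s) in A2, A4 by field.
        destruct Hx; subst x.
        * lra.
        * replace (1 / 2 + - s) with (1 / 2 - s) by ring.
          replace (1 / 2 - - s) with (1 / 2 + s) by ring. lra.
      + apply Rplus_le_compat_r.
        apply Rmult_le_reg_r with T; [lra|].
        replace (2 * M0 / T * T) with (2 * M0) by (field; lra).
        unfold T. replace (e * (1 + 2 * M0 / e)) with (e + 2 * M0) by (field; lra). lra. }
  apply le_epsilon. intros e He.
  specialize (Hmain (e / (3 + 8 * PI)) ltac:(apply Rdiv_lt_0_compat; lra)).
  assert (E : e / (3 + 8 * PI) * (3 + 8 * PI) = e) by (field; lra).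
  fold b.
  set (q := e / (3 + 8 * PI)) in *.
  assert (0 < q) by (unfold q; apply Rdiv_lt_0_compat; lra). nra.
Qed.

(** * A bounded function with value 0 and derivative 1 at 1/2 *)

Definition mobius (z : C) : C := (RtoC (3 / 2) * (z - RtoC (1 / 2)) * / (z + 1))%C.

Lemma shift_neq_0 z : 0 <= Re z -> (z + 1)%C <> RtoC 0.
Proof. intros Hz E. apply (f_equal Re) in E. simpl in E. unfold Re in Hz. lra. Qed.

Lemma shift_Cmod z : 0 <= Re z -> 1 <= Cmod (z + 1).
Proof.
  intros Hz. eapply Rle_trans; [|apply re_le_Cmod].
  rewrite Rabs_pos_eq; unfold Re in *; simpl; lra.
Qed.

Lemma mobius_half : mobius (RtoC (1 / 2)) = 0%C.
Proof. unfold mobius. ring. Qed.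

Lemma cderive_mobius z : 0 <= Re z ->
  cderive mobius z (RtoC (9 / 4) * / ((z + 1) * (z + 1)))%C.
Proof.
  intros Hz. pose proof (shift_neq_0 z Hz) as Hn.
  pose proof (cderive_comp_affine (fun w => / w)%C 1%C 1%C z (- / ((1 + 1 * z) * (1 + 1 * z)))%C) as H.
  replace (1 + 1 * z)%C with (z + 1)%C in H by ring.
  specialize (H (cderive_inv _ Hn)).
  pose proof (cderive_mult _ _ _ _ _ (cderive_const (RtoC (3 / 2)) z)
    (cderive_plus _ _ _ _ _ (cderive_id z) (cderive_const (- RtoC (1 / 2))%C z))) as H1.
  pose proof (cderive_mult _ _ _ _ _ H1 H) as H2. cbv beta in H2.
  match type of H2 with cderive _ _ ?m =>
    replace (RtoC (9 / 4) * / ((z + 1) * (z + 1)))%C with m end.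
  - refine (cderive_ext _ _ _ _ _ H2). intros w. unfold mobius, Cminus. f_equal. f_equal. ring.
  - replace (1 + 1 * z)%C with (z + 1)%C by ring.
    replace (RtoC (9 / 4)) with (RtoC (3 / 2) * RtoC (3 / 2))%C by (rewrite <- RtoC_mult; f_equal; field).
    replace (RtoC (3 / 2)) with (1 + RtoC (1 / 2))%C by (rewrite <- RtoC_plus; f_equal; field).
    field. exact Hn.
Qed.

(** A point with nonnegative real part is nearer to 1/2 than to -1. *)
Lemma mobius_bound z : 0 <= Re z -> Cmod (mobius z) <= 3 / 2.
Proof.
  intros Hz. unfold mobius. pose proof (shift_Cmod z Hz) as H1.
  rewrite !Cmod_mult, Cmod_inv, Cmod_R, Rabs_pos_eq by (try apply shift_neq_0; auto; lra).
  apply Rmult_le_reg_r with (Cmod (z + 1)); [lra|].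
  rewrite Rmult_assoc, Rinv_l, Rmult_1_r by lra.
  apply Rmult_le_compat_l; [lra|].
  destruct z as [x y]. unfold Re in Hz; simpl in Hz.
  apply sqrt_le_1_alt. simpl. nra.
Qed.

Lemma mobius_lipschitz z w : 0 <= Re z -> 0 <= Re w ->
  Cmod (mobius z - mobius w) <= 9 / 4 * Cmod (z - w).
Proof.
  intros Hz Hw. pose proof (shift_Cmod z Hz) as H1. pose proof (shift_Cmod w Hw) as H2.
  pose proof (shift_neq_0 z Hz). pose proof (shift_neq_0 w Hw).
  replace (mobius z - mobius w)%C with (RtoC (9 / 4) * ((z - w) * / ((z + 1) * (w + 1))))%C.
  - rewrite Cmod_mult, Cmod_R, Rabs_pos_eq by lra. apply Rmult_le_compat_l; [lra|].
    rewrite Cmod_mult, Cmod_inv, Cmod_mult by (apply Cmult_neq_0; auto).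
    rewrite <- (Rmult_1_r (Cmod (z - w))) at 2. apply Rmult_le_compat_l; [apply Cmod_ge_0|].
    apply Rle_trans with (/ 1); [apply Rinv_le_contravar; nra | lra].
  - unfold mobius.
    replace (RtoC (9 / 4)) with (RtoC (3 / 2) * RtoC (3 / 2))%C by (rewrite <- RtoC_mult; f_equal; field).
    replace (RtoC (3 / 2)) with (1 + RtoC (1 / 2))%C by (rewrite <- RtoC_plus; f_equal; field).
    field. auto.
Qed.

Lemma bounded_analytic_const k : bounded_analytic (fun _ => k).
Proof.
  split.
  - exists (Cmod k). intros; lra.
  - intros z _ eps Heps. exists 1. split; [lra|]. intros w _ _.
    replace (k - k)%C with (RtoC 0) by ring. rewrite Cmod_0. exact Heps.
  - intros z _. eexists. apply cderive_const.
Qed.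

Lemma bounded_analytic_plus f g : bounded_analytic f -> bounded_analytic g ->
  bounded_analytic (fun z => f z + g z)%C.
Proof.
  intros [[M HM] Hfc Hfa] [[N HN] Hgc Hga]. split.
  - exists (M + N). intros z Hz. eapply Rle_trans; [apply Cmod_triangle|].
    specialize (HM z Hz). specialize (HN z Hz). lra.
  - intros z Hz eps Heps.
    destruct (Hfc z Hz (eps / 2)) as [d1 [Hd1 H1]]; [lra|].
    destruct (Hgc z Hz (eps / 2)) as [d2 [Hd2 H2]]; [lra|].
    exists (Rmin d1 d2). split; [apply Rmin_pos; lra|]. intros w Hw Hwz.
    specialize (H1 w Hw (Rlt_le_trans _ _ _ Hwz (Rmin_l _ _))).
    specialize (H2 w Hw (Rlt_le_trans _ _ _ Hwz (Rmin_r _ _))).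
    replace (f w + g w - (f z + g z))%C with ((f w - f z) + (g w - g z))%C by ring.
    eapply Rle_lt_trans; [apply Cmod_triangle|]. lra.
  - intros z Hz. destruct (Hfa z Hz) as [l Hl]. destruct (Hga z Hz) as [m Hm].
    eexists. apply cderive_plus; eassumption.
Qed.

Lemma bounded_analytic_mult f g : bounded_analytic f -> bounded_analytic g ->
  bounded_analytic (fun z => f z * g z)%C.
Proof.
  intros [[M HM] Hfc Hfa] [[N HN] Hgc Hga]. split.
  - exists (M * N). intros z Hz. rewrite Cmod_mult.
    apply Rmult_le_compat; auto using Cmod_ge_0.
  - intros z Hz eps Heps.
    pose proof (Rle_trans _ _ _ (Cmod_ge_0 _) (HM z Hz)) as HM0.
    pose proof (Rle_trans _ _ _ (Cmod_ge_0 _) (HN z Hz)) as HN0.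
    set (q := eps / (M + N + 1)).
    assert (Hq : 0 < q) by (apply Rdiv_lt_0_compat; lra).
    assert (Eq : q * (M + N + 1) = eps) by (unfold q; field; lra).
    destruct (Hfc z Hz q Hq) as [d1 [Hd1 H1]].
    destruct (Hgc z Hz q Hq) as [d2 [Hd2 H2]].
    exists (Rmin d1 d2). split; [apply Rmin_pos; lra|]. intros w Hw Hwz.
    specialize (H1 w Hw (Rlt_le_trans _ _ _ Hwz (Rmin_l _ _))).
    specialize (H2 w Hw (Rlt_le_trans _ _ _ Hwz (Rmin_r _ _))).
    replace (f w * g w - f z * g z)%C with ((f w - f z) * g w + f z * (g w - g z))%C by ring.
    eapply Rle_lt_trans; [apply Cmod_triangle|]. rewrite !Cmod_mult.
    assert (K1 : Cmod (f w - f z) * Cmod (g w) <= q * N)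
      by (apply Rmult_le_compat; auto using Cmod_ge_0; lra).
    assert (K2 : Cmod (f z) * Cmod (g w - g z) <= M * q)
      by (apply Rmult_le_compat; auto using Cmod_ge_0; lra).
    lra.
  - intros z Hz. destruct (Hfa z Hz) as [l Hl]. destruct (Hga z Hz) as [m Hm].
    eexists. apply cderive_mult; eassumption.
Qed.

Lemma bounded_analytic_mobius : bounded_analytic mobius.
Proof.
  split.
  - exists (3 / 2). intros z Hz. apply mobius_bound, Hz.
  - intros z Hz eps Heps.
    destruct (cderive_ccont _ _ _ (cderive_mobius z (proj1 Hz)) eps Heps) as [d [Hd K]].
    exists d. auto.
  - intros z Hz. eexists. apply cderive_mobius. lra.
Qed.

Lemma mobius_derivative_half : (RtoC (9 / 4) * / ((RtoC (1 / 2) + 1) * (RtoC (1 / 2) + 1)))%C = 1%C.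
Proof. rewrite <- RtoC_plus, <- RtoC_mult, <- RtoC_inv, <- RtoC_mult by lra. f_equal. field. Qed.

(** The product [mobius * f] is at most [3 / 2 * M] on the boundary, and its
    derivative at 1/2 is [f (1 / 2)], since [mobius] has value 0 and derivative 1
    there. *)
Lemma analytic_value_bound f M : bounded_analytic f ->
  (forall z, Re z = 0 \/ Re z = 1 -> Cmod (f z) <= M) ->
  Cmod (f (RtoC (1 / 2))) <= 12 * PI * M.
Proof.
  intros Hf HM.
  destruct (ba_analytic f Hf (RtoC (1 / 2))) as [l Hl]; [simpl; lra|].
  replace (12 * PI * M) with (8 * PI * (3 / 2 * M)) by field.
  apply (analytic_derivative_bound (fun z => mobius z * f z)%C).
  - apply bounded_analytic_mult; auto using bounded_analytic_mobius.
  - intros z Hz. rewrite Cmod_mult.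
    apply Rmult_le_compat; auto using Cmod_ge_0. apply mobius_bound. lra.
  - pose proof (cderive_mult _ _ _ _ _ (cderive_mobius (RtoC (1 / 2)) ltac:(simpl; lra)) Hl) as H.
    rewrite mobius_half, mobius_derivative_half in H.
    match type of H with cderive _ _ ?m => replace (f (RtoC (1 / 2))) with m by ring end.
    exact H.
Qed.

(** * Finite sums and Euclidean norms *)

Notation rsum := (@lsum R_AbelianMonoid) (only parsing).
Notation csum := (@lsum C_AbelianMonoid) (only parsing).

Lemma rsum_cons (f : nat -> R) j A : rsum f (j :: A) = f j + rsum f A.
Proof. reflexivity. Qed.

Lemma csum_cons (f : nat -> C) j A : csum f (j :: A) = (f j + csum f A)%C.
Proof. reflexivity. Qed.

Lemma rsum_nonneg (f : nat -> R) A : (forall j, 0 <= f j) -> 0 <= rsum f A.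
Proof.
  intros Hf. induction A as [|j A IH]; [apply Rle_refl|].
  rewrite rsum_cons. specialize (Hf j). lra.
Qed.

Lemma rsum_app (f : nat -> R) A B : rsum f (A ++ B) = rsum f A + rsum f B :> R.
Proof.
  induction A as [|j A IH]; [symmetry; apply Rplus_0_l|].
  rewrite <- app_comm_cons, !rsum_cons, IH. ring.
Qed.

Lemma rsum_map (f : nat -> R) (s : nat -> nat) A : rsum f (map s A) = rsum (fun j => f (s j)) A.
Proof. induction A as [|j A IH]; [reflexivity|]. simpl map. rewrite !rsum_cons, IH. reflexivity. Qed.

Lemma rsum_le_of_support (f : nat -> R) A D : (forall j, 0 <= f j) -> NoDup A ->
  (forall j, In j A -> f j <> 0 -> In j D) -> rsum f A <= rsum f D.
Proof.
  intros Hf HA. revert D. induction HA as [|a A Ha HA IH]; intros D HD.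
  { apply rsum_nonneg; auto. }
  rewrite rsum_cons. destruct (Req_dec (f a) 0) as [E|E].
  - rewrite E, Rplus_0_l. apply IH. intros j Hj. apply HD. right; auto.
  - destruct (in_split a D (HD a (or_introl eq_refl) E)) as [D1 [D2 ->]].
    rewrite rsum_app, rsum_cons.
    specialize (IH (D1 ++ D2)). rewrite rsum_app in IH.
    assert (rsum f A <= rsum f D1 + rsum f D2); [|lra].
    apply IH. intros j Hj Hfj. specialize (HD j (or_intror Hj) Hfj).
    apply in_app_or in HD. apply in_or_app. destruct HD as [|[->|]]; tauto.
Qed.

Lemma sqsum_nonneg (x : omega) A : 0 <= rsum (fun j => Cmod (x j) ^ 2) A.
Proof. apply rsum_nonneg. intros; apply pow2_ge_0. Qed.

Lemma l2_norm_nonneg A x : 0 <= l2_norm A x.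
Proof. apply sqrt_pos. Qed.

Lemma l2_norm_sqr A x : l2_norm A x ^ 2 = rsum (fun j => Cmod (x j) ^ 2) A.
Proof. apply pow2_sqrt, sqsum_nonneg. Qed.

Lemma l2_norm_nil x : l2_norm nil x = 0.
Proof. exact sqrt_0. Qed.

(** An entry and the remaining entries are the legs of a right triangle. Through
    this recursion the properties of the Euclidean norm follow from those of the
    modulus. *)
Lemma l2_norm_cons j A x : l2_norm (j :: A) x = Cmod (Cmod (x j), l2_norm A x).
Proof.
  unfold l2_norm at 1. rewrite rsum_cons, <- l2_norm_sqr. reflexivity.
Qed.

Lemma l2_norm_le_of_support A D (x : omega) : NoDup A ->
  (forall j, In j A -> x j <> 0%C -> In j D) -> l2_norm A x <= l2_norm D x.
Proof.
  intros HA H. apply sqrt_le_1_alt. apply rsum_le_of_support; auto.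
  - intros; apply pow2_ge_0.
  - intros j Hj Hn. apply H; auto. intros E. apply Hn. rewrite E, Cmod_0. ring.
Qed.

Lemma l2_norm_ext A (x y : omega) : (forall j, In j A -> x j = y j) -> l2_norm A x = l2_norm A y.
Proof.
  intros H. induction A as [|j A IH]; [reflexivity|].
  rewrite !l2_norm_cons, IH, H; auto; [left|intros; apply H; right]; auto.
Qed.

Lemma Cmod_pair_le (a b c d : R) : 0 <= a <= c -> 0 <= b <= d -> Cmod (a, b) <= Cmod (c, d).
Proof. intros. apply sqrt_le_1_alt. simpl. nra. Qed.

Lemma l2_norm_plus A (x y : omega) :
  l2_norm A (fun j => x j + y j)%C <= l2_norm A x + l2_norm A y.
Proof.
  induction A as [|j A IH].
  { rewrite !l2_norm_nil. lra. }
  rewrite !l2_norm_cons.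
  eapply Rle_trans; [|apply Cmod_triangle].
  apply Cmod_pair_le; split; auto using Cmod_ge_0, l2_norm_nonneg, Cmod_triangle.
Qed.

Lemma Cmod_pair_scal (c a b : R) : 0 <= c -> Cmod (c * a, c * b)%R = c * Cmod (a, b).
Proof.
  intros Hc. rewrite <- (Rabs_pos_eq c Hc) at 3. rewrite <- Cmod_R, <- Cmod_mult.
  f_equal. unfold Cmult, RtoC. simpl. f_equal; ring.
Qed.

Lemma l2_norm_scal A (k : C) (x : omega) : l2_norm A (fun j => k * x j)%C = Cmod k * l2_norm A x.
Proof.
  induction A as [|j A IH].
  { rewrite !l2_norm_nil. ring. }
  rewrite !l2_norm_cons, IH, Cmod_mult.
  apply Cmod_pair_scal, Cmod_ge_0.
Qed.

Lemma l2_norm_app A D x : l2_norm (A ++ D) x <= l2_norm A x + l2_norm D x.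
Proof.
  apply Rsqr_incr_0_var.
  - rewrite !Rsqr_pow2, l2_norm_sqr, rsum_app, <- !l2_norm_sqr.
    pose proof (l2_norm_nonneg A x). pose proof (l2_norm_nonneg D x). nra.
  - pose proof (l2_norm_nonneg A x). pose proof (l2_norm_nonneg D x). lra.
Qed.

Lemma inner_le_Cmod (a b c d : R) : a * c + b * d <= Cmod (a, b) * Cmod (c, d).
Proof.
  rewrite <- (Cmod_conj (c, d)), <- Cmod_mult.
  eapply Rle_trans; [|apply re_le_Cmod]. eapply Rle_trans; [|apply Rle_abs].
  unfold Re, Cconj, Cmult; simpl. lra.
Qed.

Lemma cauchy_schwarz A (x y : omega) :
  Cmod (csum (fun j => x j * y j)%C A) <= l2_norm A x * l2_norm A y.
Proof.
  induction A as [|j A IH].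
  { rewrite !l2_norm_nil. change (Cmod 0 <= 0 * 0). rewrite Cmod_0. lra. }
  rewrite csum_cons. eapply Rle_trans; [apply Cmod_triangle|]. rewrite Cmod_mult, !l2_norm_cons.
  pose proof (Cmod_ge_0 (x j)). pose proof (Cmod_ge_0 (y j)).
  pose proof (l2_norm_nonneg A x). pose proof (l2_norm_nonneg A y).
  set (p := Cmod (x j)) in *. set (q := Cmod (y j)) in *.
  set (u := l2_norm A x) in *. set (v := l2_norm A y) in *.
  apply Rle_trans with (p * q + u * v); [lra|]. apply inner_le_Cmod.
Qed.

Lemma csum_ext_in (f g : nat -> C) A : (forall j, In j A -> f j = g j) ->
  csum f A = csum g A :> C.
Proof.
  intros H. induction A as [|a A IH]; [reflexivity|].
  rewrite !csum_cons, IH, (H a); auto; [left|intros; apply H; right]; auto.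
Qed.

Lemma csum_scal (k : C) (f : nat -> C) A : csum (fun j => k * f j)%C A = (k * csum f A)%C.
Proof.
  induction A as [|a A IH]; [symmetry; apply Cmult_0_r|].
  rewrite !csum_cons, IH. symmetry. apply Cmult_plus_distr_l.
Qed.

Lemma l2_norm_conj A (x : omega) : l2_norm A (fun j => Cconj (x j)) = l2_norm A x.
Proof.
  induction A as [|j A IH]; [reflexivity|].
  rewrite !l2_norm_cons, IH, Cmod_conj. reflexivity.
Qed.

Lemma csum_conj_mult A (x : omega) :
  csum (fun j => Cconj (x j) * x j)%C A = RtoC (l2_norm A x ^ 2) :> C.
Proof.
  rewrite l2_norm_sqr. induction A as [|j A IH]; [reflexivity|].
  rewrite csum_cons, rsum_cons, IH, RtoC_plus, Cmod2_conj. ring.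
Qed.

(** Test with the conjugate of [v]. *)
Lemma l2_norm_by_duality B (v : omega) k : 0 <= k ->
  (forall u : omega, Cmod (csum (fun j => u j * v j)%C B) <= k * l2_norm B u) ->
  l2_norm B v <= k.
Proof.
  intros Hk H. specialize (H (fun j => Cconj (v j))). cbv beta in H.
  rewrite csum_conj_mult, l2_norm_conj, Cmod_R, Rabs_pos_eq in H by apply pow2_ge_0.
  pose proof (l2_norm_nonneg B v) as [Hp|Hp]; nra.
Qed.

Definition restrict (A : list nat) (a : nat -> C) : omega :=
  fun j => if in_dec Nat.eq_dec j A then a j else 0%C.

Lemma restrict_in A a j : In j A -> restrict A a j = a j.
Proof. intros Hj. unfold restrict. destruct (in_dec Nat.eq_dec j A); [auto|contradiction]. Qed.

Lemma restrict_notin A a j : ~ In j A -> restrict A a j = 0%C.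
Proof. intros Hj. unfold restrict. destruct (in_dec Nat.eq_dec j A); [contradiction|auto]. Qed.

(** * The Schreier space and its dual on finite sets *)

Definition supported_on (B : list nat) (x : omega) : Prop :=
  forall j, ~ In j B -> x j = 0%C.

Lemma eq_in_C_NormedModule (x y : C) : @eq C x y -> @eq (NormedModule.sort C_AbsRing C_NormedModule) x y.
Proof. auto. Qed.

Lemma is_series_single (b : nat) (c : C) :
  is_series (V := C_NormedModule) (fun j => if Nat.eqb j b then c else RtoC 0) c.
Proof.
  apply filterlim_ext_loc with (fun _ => c); [|apply filterlim_const].
  exists b. intros n Hn.
  assert (H : forall m, sum_n (G := C_AbelianMonoid) (fun j => if Nat.eqb j b then c else RtoC 0) m
     = if Nat.leb b m then c else RtoC 0).
  { induction m.
    - rewrite sum_O. destruct b; reflexivity.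
    - rewrite sum_Sn, IHm. change plus with Cplus.
      destruct (Nat.leb_spec b m), (Nat.eqb_spec (S m) b), (Nat.leb_spec b (S m)); try lia; apply eq_in_C_NormedModule; ring. }
  symmetry. etransitivity; [apply H|]. destruct (Nat.leb_spec b n); [reflexivity|lia].
Qed.

Lemma is_series_supported B (z : omega) : NoDup B -> supported_on B z ->
  is_series (V := C_NormedModule) z (csum z B).
Proof.
  intros HB. revert z. induction HB as [|b B Hb HB IH]; intros z Hz.
  - apply is_series_ext with (fun _ => RtoC 0).
    + intros n. symmetry. apply Hz. intros [].
    + apply filterlim_ext_loc with (fun _ => RtoC 0); [|apply filterlim_const].
      exists 0%nat. intros n _. symmetry.
      induction n; [apply sum_O|]. rewrite sum_Sn. etransitivity; [apply (f_equal2 Cplus IHn eq_refl)|].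
      apply Cplus_0_l.
  - rewrite csum_cons.
    apply is_series_ext with (fun j => plus (if Nat.eqb j b then z b else RtoC 0) (if Nat.eqb j b then RtoC 0 else z j)).
    { intros n. change plus with Cplus. destruct (Nat.eqb_spec n b); [subst|]; apply eq_in_C_NormedModule; ring. }
    apply (is_series_plus (V := C_NormedModule)).
    + apply is_series_single.
    + replace (csum z B) with (csum (fun j => if Nat.eqb j b then RtoC 0 else z j) B).
      * apply IH. intros j Hj. destruct (Nat.eqb_spec j b); auto.
        apply Hz. intros [E|E]; auto.
      * apply csum_ext_in. intros c Hc. destruct (Nat.eqb_spec c b); auto.
        subst. contradiction.
Qed.

Lemma is_series_supported_eq B (x y : omega) (s : C) : NoDup B -> supported_on B (fun j => x j * y j)%C ->
  is_series (V := C_NormedModule) (fun j => x j * y j)%C s -> s = csum (fun j => x j * y j)%C B.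
Proof.
  intros HB Hz Hs.
  exact (filterlim_locally_unique _ _ _ Hs (is_series_supported B _ HB Hz)).
Qed.

Lemma real_le (r : Rbar) (k : R) : 0 <= k -> Rbar_le r k -> real r <= k.
Proof. intros Hk. destruct r; simpl; tauto. Qed.

Lemma le_real_Lub (E : R -> Prop) (k : R) r : (forall r, E r -> r <= k) -> E r ->
  r <= real (Lub_Rbar E).
Proof.
  intros Hk Hr. destruct (Lub_Rbar_correct E) as [H1 H2].
  specialize (H1 r Hr). specialize (H2 (Finite k) (fun r Hr => Hk r Hr)).
  destruct (Lub_Rbar E); simpl in *; tauto.
Qed.

Lemma real_Lub_le (E : R -> Prop) (k : R) : 0 <= k -> (forall r, E r -> r <= k) ->
  real (Lub_Rbar E) <= k.
Proof.
  intros Hk H. apply real_le; auto. apply (Lub_Rbar_correct E). intros r Hr. apply H, Hr.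
Qed.

(** What needs proof is that the supremum defining the norm of a member is
    finite, as [real] would otherwise turn it into 0: [x] is at distance less
    than 1 from a finitely supported sequence. *)
Lemma l2_le_schreier2_norm x A : mem_of schreier2 x -> admissible A ->
  l2_norm A x <= norm_of schreier2 x.
Proof.
  intros Hx HA. destruct (Hx 1 Rlt_0_1) as [y [[N Hy] Hxy]].
  apply le_real_Lub with (1 + l2_norm (seq 0 N) y); [|exists A; auto].
  intros r [D [[HD HD'] ->]].
  rewrite (l2_norm_ext D x (fun j => omega_minus x y j + y j)%C)
    by (intros; unfold omega_minus; ring).
  eapply Rle_trans; [apply l2_norm_plus|]. apply Rplus_le_compat.
  - destruct (Lub_Rbar_correct (fun r => exists A, admissible A /\ r = l2_norm A (omega_minus x y))) as [H1 _].
    pose proof (H1 _ (ex_intro _ D (conj (conj HD HD') eq_refl))) as H2.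
    apply Rlt_le. exact (Rbar_le_lt_trans _ _ _ H2 Hxy).
  - apply l2_norm_le_of_support; auto. intros j _ Hj. apply in_seq.
    destruct (Nat.le_gt_cases N j); [|lia]. exfalso; apply Hj, Hy; auto.
Qed.

Lemma schreier2_norm_nonneg x : mem_of schreier2 x -> 0 <= norm_of schreier2 x.
Proof.
  intros Hx. eapply Rle_trans; [apply (l2_norm_nonneg nil x)|].
  apply l2_le_schreier2_norm; auto. split; [constructor|intros j []].
Qed.

(** An admissible set only sees the part of [x] in [B]. *)
Lemma schreier2_norm_le B x : supported_on B x -> norm_of schreier2 x <= l2_norm B x.
Proof.
  intros Hx. apply real_Lub_le; [apply l2_norm_nonneg|].
  intros r [D [[HD _] ->]]. apply l2_norm_le_of_support; auto.
  intros j _ Hj. destruct (in_dec Nat.eq_dec j B); auto. exfalso; apply Hj, Hx; auto.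
Qed.

Lemma schreier2_mem B x : supported_on B x -> mem_of schreier2 x.
Proof.
  intros Hx eps Heps. exists x. split.
  - exists (S (list_max B)). intros j Hj. apply Hx. intros Hin.
    pose proof (proj1 (list_max_le B (list_max B)) (Nat.le_refl _)) as H.
    rewrite Forall_forall in H. specialize (H j Hin). lia.
  - apply Rbar_le_lt_trans with (Finite 0); [|exact Heps].
    apply (Lub_Rbar_correct (fun r => exists A, admissible A /\ r = l2_norm A (omega_minus x x))).
    intros r [D [_ ->]].
    rewrite (l2_norm_ext D _ (fun j => 0 * x j)%C) by (intros; unfold omega_minus; ring).
    rewrite l2_norm_scal, Cmod_0, Rmult_0_l. apply Rle_refl.
Qed.

Lemma supported_mult_l B (x y : omega) : supported_on B x -> supported_on B (fun j => x j * y j)%C.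
Proof. intros H j Hj. rewrite H by auto. ring. Qed.

Lemma supported_mult_r B (x y : omega) : supported_on B y -> supported_on B (fun j => x j * y j)%C.
Proof. intros H j Hj. rewrite H by auto. ring. Qed.

(** The functional [y] is tested on the normalized conjugate of its restriction
    to [B], whose Schreier norm is at most its Euclidean norm 1. *)
Lemma l2_le_dual_norm B y : mem_of (dual schreier2) y -> NoDup B ->
  l2_norm B y <= norm_of (dual schreier2) y.
Proof.
  intros [M HM] HB.
  set (n := l2_norm B y).
  assert (Hn : 0 <= n) by apply l2_norm_nonneg.
  (* for [n = 0] this is the zero sequence, whatever [/ n] is *)
  set (x := (fun j => RtoC (/ n) * restrict B (fun i => Cconj (y i)) j)%C : omega).
  assert (Hx : supported_on B x).
  { intros j Hj. unfold x. rewrite restrict_notin by auto. ring. }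
  assert (Hxn : l2_norm B x <= 1).
  { unfold x. rewrite l2_norm_scal, Cmod_R.
    rewrite (l2_norm_ext B _ (fun j => Cconj (y j))) by (intros; apply restrict_in; auto).
    rewrite l2_norm_conj. fold n.
    destruct (Req_dec n 0) as [->|Hn0]; [lra|].
    rewrite Rabs_pos_eq by (apply Rlt_le, Rinv_0_lt_compat; lra). rewrite Rinv_l by lra. lra. }
  assert (Hs : csum (fun j => x j * y j)%C B = RtoC (/ n * n ^ 2) :> C).
  { rewrite (csum_ext_in _ (fun j => RtoC (/ n) * (Cconj (y j) * y j))%C).
    - rewrite csum_scal, csum_conj_mult, <- RtoC_mult. reflexivity.
    - intros j Hj. unfold x. rewrite restrict_in by auto. ring. }
  apply Rle_trans with (Cmod (RtoC (/ n * n ^ 2))).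
  { rewrite Cmod_R. eapply Rle_trans; [|apply Rle_abs].
    destruct (Req_dec n 0) as [->|Hn0]; [lra|]. right; field; auto. }
  apply le_real_Lub with (Rmax 0 M).
  - intros r [x' [s [Hx' [Hn' [Hs' ->]]]]].
    destruct (HM x' Hx') as [s' [Hs'' Hle]].
    rewrite (filterlim_locally_unique _ _ _ Hs' Hs'').
    pose proof (schreier2_norm_nonneg x' Hx').
    pose proof (Rmax_l 0 M). pose proof (Rmax_r 0 M). nra.
  - exists x, (RtoC (/ n * n ^ 2)). split; [eapply schreier2_mem; eauto|].
    split; [eapply Rle_trans; [apply schreier2_norm_le; eauto|exact Hxn]|].
    split; auto. rewrite <- Hs. apply is_series_supported; auto. apply supported_mult_l; auto.
Qed.

Lemma schreier2_controls_l2 x A1 A2 : mem_of schreier2 x -> admissible A1 -> admissible A2 ->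
  l2_norm (A1 ++ A2) x <= 2 * norm_of schreier2 x.
Proof.
  intros Hx H1 H2. eapply Rle_trans; [apply l2_norm_app|].
  pose proof (l2_le_schreier2_norm x A1 Hx H1). pose proof (l2_le_schreier2_norm x A2 Hx H2). lra.
Qed.

Lemma dual_pairing_bound A1 A2 x y s : admissible A1 -> admissible A2 -> NoDup (A1 ++ A2) ->
  supported_on (A1 ++ A2) y -> mem_of schreier2 x ->
  is_series (V := C_NormedModule) (fun j => x j * y j)%C s ->
  Cmod s <= 2 * l2_norm (A1 ++ A2) y * norm_of schreier2 x.
Proof.
  intros H1 H2 HB Hy Hx Hs.
  rewrite (is_series_supported_eq _ _ _ _ HB (supported_mult_r _ x y Hy) Hs).
  eapply Rle_trans; [apply cauchy_schwarz|].
  pose proof (schreier2_controls_l2 x A1 A2 Hx H1 H2).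
  pose proof (l2_norm_nonneg (A1 ++ A2) y). nra.
Qed.

Lemma dual_mem A1 A2 y : admissible A1 -> admissible A2 -> NoDup (A1 ++ A2) ->
  supported_on (A1 ++ A2) y -> mem_of (dual schreier2) y.
Proof.
  intros H1 H2 HB Hy. exists (2 * l2_norm (A1 ++ A2) y). intros x Hx.
  pose proof (is_series_supported _ _ HB (supported_mult_r _ x y Hy)) as Hs.
  eexists; split; [exact Hs|]. eapply dual_pairing_bound; eauto.
Qed.

Lemma dual_norm_le A1 A2 y : admissible A1 -> admissible A2 -> NoDup (A1 ++ A2) ->
  supported_on (A1 ++ A2) y -> norm_of (dual schreier2) y <= 2 * l2_norm (A1 ++ A2) y.
Proof.
  intros H1 H2 HB Hy. pose proof (l2_norm_nonneg (A1 ++ A2) y).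
  apply real_Lub_le; [lra|].
  intros r [x [s [Hx [Hx1 [Hs ->]]]]].
  pose proof (dual_pairing_bound A1 A2 x y s H1 H2 HB Hy Hx Hs).
  pose proof (schreier2_norm_nonneg x Hx). nra.
Qed.

(** * The lower estimate of the derived norm *)

Lemma ball_Cmod (x y : C) (eps : posreal) : ball (x : C_UniformSpace) eps y -> Cmod (y - x) < 2 * eps.
Proof.
  intros H. eapply Rlt_le_trans; [apply (C_NormedModule_mixin_compat2 x y eps H)|].
  apply Rmult_le_compat_r; [apply Rlt_le, cond_pos|].
  replace 2 with (sqrt (2 * 2)) at 2 by (apply sqrt_square; lra).
  apply sqrt_le_1_alt; lra.
Qed.

Lemma filterlim_strip_iff (f : C -> C) (z : C) :
  filterlim f (within strip (locally (z : C_UniformSpace))) (locally (f z : C_UniformSpace)) <->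
  (forall eps, 0 < eps -> exists delta, 0 < delta /\
     forall w, strip w -> Cmod (w - z) < delta -> Cmod (f w - f z) < eps).
Proof.
  split.
  - intros H eps Heps.
    assert (He : 0 < eps / 2) by lra.
    destruct (H (fun v => ball (f z : C_UniformSpace) (eps / 2) v)) as [d Hd].
    { exists (mkposreal _ He). intros v Hv; exact Hv. }
    exists d. split; [apply cond_pos|]. intros w Hw Hwz.
    specialize (Hd w (C_NormedModule_mixin_compat1 z w d Hwz) Hw).
    pose proof (ball_Cmod _ _ (mkposreal _ He) Hd). simpl in H0. lra.
  - intros H P [e He].
    destruct (H e (cond_pos e)) as [d [Hd K]].
    assert (Hd2 : 0 < d / 2) by lra.
    exists (mkposreal _ Hd2). intros w Hw Hs. apply He.
    apply C_NormedModule_mixin_compat1. apply K; auto.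
    pose proof (ball_Cmod _ _ (mkposreal _ Hd2) Hw). simpl in H0. lra.
Qed.

Lemma bounded_analytic_coord X Y F j : F_infty X Y F -> bounded_analytic (fun z => F z j).
Proof.
  intros H. split.
  - apply (F_bounded _ _ _ H).
  - intros z Hz. apply filterlim_strip_iff. apply (F_continuous _ _ _ H j z Hz).
  - intros z Hz. destruct (F_analytic _ _ _ H j z Hz) as [l Hl]. exists l.
    apply is_derive_cderive, Hl.
Qed.

Lemma bounded_analytic_csum X Y F u B : F_infty X Y F ->
  bounded_analytic (fun z => csum (fun j => u j * F z j)%C B).
Proof.
  intros H. induction B as [|b B IH]; [apply (bounded_analytic_const (RtoC 0))|].
  apply (bounded_analytic_plus (fun z => u b * F z b)%C); auto.
  apply bounded_analytic_mult; [apply bounded_analytic_const|].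
  eapply bounded_analytic_coord; eauto.
Qed.

Lemma cderive_csum (F : C -> omega) (x u : omega) z B :
  (forall j, cderive (fun w => F w j) z (x j)) ->
  cderive (fun w => csum (fun j => u j * F w j)%C B) z (csum (fun j => u j * x j)%C B).
Proof.
  intros H. induction B as [|b B IH]; [apply (cderive_const (RtoC 0))|].
  apply (cderive_plus (fun w => u b * F w b)%C _ z (u b * x b)%C); auto.
  pose proof (cderive_mult _ _ _ _ _ (cderive_const (u b) z) (H b)) as Hm.
  match type of Hm with cderive _ _ ?m => replace (u b * x b)%C with m by ring end.
  exact Hm.
Qed.

Lemma norm_le_sup_R X g : bounded_continuous X g -> forall t,
  norm_of X (g t) <= sup_R (fun t => norm_of X (g t)).
Proof.
  intros [_ [[M HM] _]] t. apply le_real_Lub with M; [|exists t; reflexivity].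
  intros r [s ->]. apply HM.
Qed.

(** On the left side the splitting into two admissible sets costs a factor 2; on
    the right side the dual norm dominates the Euclidean norm of any finite
    part. *)
Lemma boundary_bound F A1 A2 u z :
  F_infty schreier2 (dual schreier2) F ->
  admissible A1 -> admissible A2 -> NoDup (A1 ++ A2) ->
  Re z = 0 \/ Re z = 1 ->
  Cmod (csum (fun j => u j * F z j)%C (A1 ++ A2))
    <= 2 * F_norm schreier2 (dual schreier2) F * l2_norm (A1 ++ A2) u.
Proof.
  intros HF H1 H2 HB Hz.
  eapply Rle_trans; [apply cauchy_schwarz|]. rewrite Rmult_comm.
  apply Rmult_le_compat_r; [apply l2_norm_nonneg|].
  pose proof (norm_le_sup_R _ _ (F_left _ _ _ HF) (Im z)) as HL.
  pose proof (norm_le_sup_R _ _ (F_right _ _ _ HF) (Im z)) as HR.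
  pose proof (Rmax_l (sup_R (fun t => norm_of schreier2 (left_side F t)))
    (sup_R (fun t => norm_of (dual schreier2) (right_side F t)))) as Ml.
  pose proof (Rmax_r (sup_R (fun t => norm_of schreier2 (left_side F t)))
    (sup_R (fun t => norm_of (dual schreier2) (right_side F t)))) as Mr.
  fold (F_norm schreier2 (dual schreier2) F) in Ml, Mr.
  pose proof (schreier2_controls_l2 _ A1 A2 (proj1 (F_left _ _ _ HF) (Im z)) H1 H2) as KL.
  pose proof (l2_le_dual_norm (A1 ++ A2) _ (proj1 (F_right _ _ _ HF) (Im z)) HB) as KR.
  pose proof (schreier2_norm_nonneg _ (proj1 (F_left _ _ _ HF) (Im z))) as PL.
  destruct Hz as [Hz|Hz].
  - replace (F z) with (left_side F (Im z)).
    + lra.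
    + unfold left_side. f_equal. destruct z as [a b]; simpl in *. subst a.
      unfold RtoC, Ci, Cmult; simpl. f_equal; ring.
  - replace (F z) with (right_side F (Im z)).
    + lra.
    + unfold right_side. f_equal. destruct z as [a b]; simpl in *. subst a.
      unfold RtoC, Ci, Cmult, Cplus; simpl. f_equal; ring.
Qed.

(** [40 = 16 + 24], where [16 = 8 * 2] and [24 = 12 * 2] combine the constants
    of the two Cauchy estimates with that of [boundary_bound]. *)
Lemma F_norm_lower F x y A1 A2 :
  F_infty schreier2 (dual schreier2) F ->
  (forall j, F (RtoC (1 / 2)) j = y j) ->
  (forall j, is_derive (fun w => F w j) (RtoC (1 / 2)) (x j)) ->
  admissible A1 -> admissible A2 -> NoDup (A1 ++ A2) ->
  l2_norm (A1 ++ A2) x + l2_norm (A1 ++ A2) y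
    <= 40 * PI * F_norm schreier2 (dual schreier2) F.
Proof.
  intros HF Hy Hx H1 H2 HB. set (N := F_norm schreier2 (dual schreier2) F).
  pose proof PI_RGT_0.
  assert (HN : 0 <= N).
  { eapply Rle_trans; [|apply Rmax_l].
    eapply Rle_trans; [apply (schreier2_norm_nonneg _ (proj1 (F_left _ _ _ HF) 0))|].
    apply (norm_le_sup_R _ _ (F_left _ _ _ HF) 0). }
  assert (Hb : forall u z, Re z = 0 \/ Re z = 1 ->
    Cmod (csum (fun j => u j * F z j)%C (A1 ++ A2)) <= 2 * N * l2_norm (A1 ++ A2) u).
  { intros u z Hz. apply boundary_bound; auto. }
  assert (Hxx : l2_norm (A1 ++ A2) x <= 16 * PI * N).
  { apply l2_norm_by_duality; [nra|]. intros u.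
    replace (16 * PI * N * l2_norm (A1 ++ A2) u)
      with (8 * PI * (2 * N * l2_norm (A1 ++ A2) u)) by ring.
    apply (analytic_derivative_bound (fun z => csum (fun j => u j * F z j)%C (A1 ++ A2))); auto.
    - eapply bounded_analytic_csum; eauto.
    - apply cderive_csum. intros j. apply is_derive_cderive, Hx. }
  assert (Hyy : l2_norm (A1 ++ A2) y <= 24 * PI * N).
  { apply l2_norm_by_duality; [nra|]. intros u.
    replace (24 * PI * N * l2_norm (A1 ++ A2) u)
      with (12 * PI * (2 * N * l2_norm (A1 ++ A2) u)) by ring.
    rewrite (csum_ext_in _ (fun j => u j * F (RtoC (1 / 2)) j)%C) by (intros; rewrite Hy; reflexivity).
    apply (analytic_value_bound (fun z => csum (fun j => u j * F z j)%C (A1 ++ A2))); auto.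
    eapply bounded_analytic_csum; eauto. }
  lra.
Qed.

(** * The upper estimate of the derived norm *)

Definition affine_family (x y : omega) (z : C) : omega := fun j => (y j + mobius z * x j)%C.

Lemma supported_affine B x y z : supported_on B x -> supported_on B y ->
  supported_on B (affine_family x y z).
Proof. intros Hx Hy j Hj. unfold affine_family. rewrite Hx, Hy by auto. ring. Qed.

(** Both sides of the strip at once: [c] parametrizes one of them, and [X] is the
    space attached to it, which is Euclidean up to a factor 2 on vectors
    supported by [B]. *)
Lemma affine_family_side X B (x y : omega) (c : R -> C) :
  supported_on B x -> supported_on B y ->
  (forall v, supported_on B v -> mem_of X v /\ norm_of X v <= 2 * l2_norm B v) ->
  (forall t, 0 <= Re (c t)) -> (forall s t, Cmod (c s - c t) = Rabs (s - t)) ->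
  let g t := affine_family x y (c t) in
  bounded_continuous X g /\
  sup_R (fun t => norm_of X (g t)) <= 2 * l2_norm B y + 3 * l2_norm B x.
Proof.
  intros Hx Hy HX Hc Hcc g.
  pose proof (l2_norm_nonneg B x) as Px. pose proof (l2_norm_nonneg B y) as Py.
  assert (Hg : forall t, norm_of X (g t) <= 2 * l2_norm B y + 3 * l2_norm B x).
  { intros t. eapply Rle_trans; [apply HX, supported_affine; auto|].
    apply Rle_trans with (2 * (l2_norm B y + l2_norm B (fun j => mobius (c t) * x j)%C)).
    { apply Rmult_le_compat_l; [lra|]. apply l2_norm_plus. }
    rewrite l2_norm_scal. pose proof (mobius_bound (c t) (Hc t)). nra. }
  split.
  - split; [|split].
    + intros t. apply HX, supported_affine; auto.
    + exists (2 * l2_norm B y + 3 * l2_norm B x). exact Hg.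
    + intros t eps Heps. exists (eps / (5 * (l2_norm B x + 1))).
      split; [apply Rdiv_lt_0_compat; lra|]. intros s Hs.
      assert (Hd : supported_on B (omega_minus (g s) (g t))).
      { intros j Hj. unfold omega_minus, g.
        rewrite !(supported_affine B x y _ Hx Hy j Hj). ring. }
      eapply Rle_lt_trans; [apply (HX _ Hd)|].
      rewrite (l2_norm_ext B _ (fun j => (mobius (c s) - mobius (c t)) * x j)%C)
        by (intros; unfold omega_minus, g, affine_family; ring).
      rewrite l2_norm_scal.
      pose proof (mobius_lipschitz (c s) (c t) (Hc s) (Hc t)) as HL. rewrite Hcc in HL.
      apply Rmult_lt_compat_r with (r := 5 * (l2_norm B x + 1)) in Hs; [|lra].
      replace (eps / (5 * (l2_norm B x + 1)) * (5 * (l2_norm B x + 1))) with eps in Hs by (field; lra).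
      pose proof (Rabs_pos (s - t)). nra.
  - apply real_Lub_le; [lra|]. intros r [t ->]. apply Hg.
Qed.

Lemma cderive_affine_family (x y : omega) j z : 0 <= Re z ->
  cderive (fun w => affine_family x y w j) z
    (RtoC (9 / 4) * / ((z + 1) * (z + 1)) * x j)%C.
Proof.
  intros Hz.
  pose proof (cderive_mult _ _ _ _ _ (cderive_mobius z Hz) (cderive_const (x j) z)) as H1.
  pose proof (cderive_plus _ _ _ _ _ (cderive_const (y j) z) H1) as H2.
  match type of H2 with cderive _ _ ?m =>
    replace (RtoC (9 / 4) * / ((z + 1) * (z + 1)) * x j)%C with m by ring end.
  exact H2.
Qed.

Lemma affine_family_F_infty A1 A2 (x y : omega) :
  admissible A1 -> admissible A2 -> NoDup (A1 ++ A2) ->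
  supported_on (A1 ++ A2) x -> supported_on (A1 ++ A2) y ->
  F_infty schreier2 (dual schreier2) (affine_family x y) /\
  F_norm schreier2 (dual schreier2) (affine_family x y)
    <= 2 * l2_norm (A1 ++ A2) y + 3 * l2_norm (A1 ++ A2) x.
Proof.
  intros H1 H2 HB Hx Hy.
  destruct (affine_family_side schreier2 (A1 ++ A2) x y (fun t => t * Ci)%C) as [L1 L2]; auto.
  { intros v Hv. split; [eapply schreier2_mem; eauto|].
    pose proof (schreier2_norm_le _ _ Hv). pose proof (l2_norm_nonneg (A1 ++ A2) v). lra. }
  { intros t. simpl. lra. }
  { intros s t. replace (s * Ci - t * Ci)%C with (Ci * RtoC (s - t))%C by (rewrite RtoC_minus; ring).
    rewrite Cmod_mult, Cmod_Ci, Cmod_R. ring. }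
  destruct (affine_family_side (dual schreier2) (A1 ++ A2) x y (fun t => 1 + t * Ci)%C) as [R1 R2]; auto.
  { intros v Hv. split; [apply (dual_mem A1 A2); auto|]. apply dual_norm_le; auto. }
  { intros t. simpl. lra. }
  { intros s t. replace (1 + s * Ci - (1 + t * Ci))%C with (Ci * RtoC (s - t))%C by (rewrite RtoC_minus; ring).
    rewrite Cmod_mult, Cmod_Ci, Cmod_R. ring. }
  split; [|apply Rmax_lub; assumption].
  split; auto.
  - intros j. exists (Cmod (y j) + 3 / 2 * Cmod (x j)). intros z Hz.
    eapply Rle_trans; [apply Cmod_triangle|]. rewrite Cmod_mult.
    pose proof (mobius_bound z (proj1 Hz)). pose proof (Cmod_ge_0 (x j)). nra.
  - intros j z Hz. apply filterlim_strip_iff. intros eps Heps.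
    destruct (cderive_ccont _ _ _ (cderive_affine_family x y j z (proj1 Hz)) eps Heps) as [d [Hd K]].
    exists d. split; auto.
  - intros j z Hz. eexists. apply is_derive_cderive. apply cderive_affine_family. lra.
Qed.

Lemma derived_norm_bounds A1 A2 (x y : omega) :
  admissible A1 -> admissible A2 -> NoDup (A1 ++ A2) ->
  supported_on (A1 ++ A2) x -> supported_on (A1 ++ A2) y ->
  Rbar_le (/ (40 * PI) * (l2_norm (A1 ++ A2) x + l2_norm (A1 ++ A2) y))
    (derived_norm schreier2 (x, y)) /\
  Rbar_le (derived_norm schreier2 (x, y))
    (2 * l2_norm (A1 ++ A2) y + 3 * l2_norm (A1 ++ A2) x).
Proof.
  intros H1 H2 HB Hx Hy. pose proof PI_RGT_0.
  unfold derived_norm.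
  match goal with |- context [Glb_Rbar ?E] => destruct (Glb_Rbar_correct E) as [G1 G2] end.
  split.
  - apply G2. intros r [F [HF [Fy [Fx ->]]]]. simpl.
    apply Rmult_le_reg_l with (40 * PI); [lra|].
    rewrite <- Rmult_assoc, Rinv_r, Rmult_1_l by lra.
    apply F_norm_lower; auto.
  - destruct (affine_family_F_infty A1 A2 x y H1 H2 HB Hx Hy) as [HF HN].
    apply Rbar_le_trans with (Finite (F_norm schreier2 (dual schreier2) (affine_family x y))); [|exact HN].
    apply G1. exists (affine_family x y). split; [exact HF|]. split; [|split; [|reflexivity]].
    + intros j. unfold affine_family. rewrite mobius_half. simpl. ring.
    + intros j. apply is_derive_cderive.
      pose proof (cderive_affine_family x y j (RtoC (1 / 2)) ltac:(simpl; lra)) as Hd.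
      rewrite mobius_derivative_half, Cmult_1_l in Hd. exact Hd.
Qed.

(** * Combinations of the basis vectors *)

Lemma csum_select A (a : nat -> C) m : NoDup A ->
  csum (fun j => a j * (if Nat.eqb j m then 1 else 0))%C A = restrict A a m :> C.
Proof.
  unfold restrict. induction 1 as [|b A Hb HA IH]; [reflexivity|].
  rewrite csum_cons, IH.
  destruct (Nat.eqb_spec b m) as [->|Hbm].
  - destruct (in_dec Nat.eq_dec m A); [contradiction|].
    destruct (in_dec Nat.eq_dec m (m :: A)) as [_|N]; [ring|exfalso; apply N; left; auto].
  - destruct (in_dec Nat.eq_dec m A) as [I|I], (in_dec Nat.eq_dec m (b :: A)) as [J|J]; try ring.
    + exfalso; apply J; right; auto.
    + destruct J; contradiction.
Qed.

(** The coefficients with even index are the entries of the first component,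
    those with odd index the entries of the second. *)
Lemma lincomb_fst A a k : NoDup A ->
  fst (lincomb A a derived_basis) k = restrict A a (2 * k)%nat.
Proof.
  intros HA. rewrite <- csum_select by auto. apply csum_ext_in. intros j _. f_equal.
  unfold derived_basis. pose proof (Nat.div2_odd j) as Hj. rewrite <- Nat.negb_odd.
  destruct (Nat.odd j); simpl negb; cbv iota; simpl fst; unfold unit_vector, omega_zero;
    simpl Nat.b2n in Hj.
  - destruct (Nat.eqb_spec j (2 * k)%nat); [lia|reflexivity].
  - destruct (Nat.eqb_spec k (Nat.div2 j)), (Nat.eqb_spec j (2 * k)%nat); try lia; reflexivity.
Qed.

Lemma lincomb_snd A a k : NoDup A ->
  snd (lincomb A a derived_basis) k = restrict A a (2 * k + 1)%nat.
Proof.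
  intros HA. rewrite <- csum_select by auto. apply csum_ext_in. intros j _. f_equal.
  unfold derived_basis. pose proof (Nat.div2_odd j) as Hj. rewrite <- Nat.negb_odd.
  destruct (Nat.odd j); simpl negb; cbv iota; simpl snd; unfold unit_vector, omega_zero;
    simpl Nat.b2n in Hj.
  - destruct (Nat.eqb_spec k (Nat.div2 j)), (Nat.eqb_spec j (2 * k + 1)%nat); try lia; reflexivity.
  - destruct (Nat.eqb_spec j (2 * k + 1)%nat); [lia|reflexivity].
Qed.

Lemma l2_norm_map A (s : nat -> nat) (x : omega) :
  l2_norm (map s A) x = l2_norm A (fun j => x (s j)).
Proof. unfold l2_norm. f_equal. apply (rsum_map (fun j => Cmod (x j) ^ 2)). Qed.

Lemma l2_norm_restrict_le A a D : NoDup D -> l2_norm D (restrict A a) <= l2_norm A a.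
Proof.
  intros HD.
  rewrite (l2_norm_ext A a (restrict A a)) by (intros; symmetry; apply restrict_in; auto).
  apply l2_norm_le_of_support; auto. intros j _ Hj.
  destruct (in_dec Nat.eq_dec j A); auto. exfalso. apply Hj, restrict_notin; auto.
Qed.

(** Cut [B] at [h], half of [n] rounded up: both pieces have at most [h]
    elements, and [n <= 2 * k + 1] gives [h <= k + 1]. *)
Lemma split_admissible n B : NoDup B -> (length B <= n)%nat ->
  (forall k, In k B -> (n <= 2 * k + 1)%nat) ->
  exists A1 A2, admissible A1 /\ admissible A2 /\ B = A1 ++ A2.
Proof.
  intros HB Hlen Hk.
  assert (exists h, (n <= 2 * h <= n + 1)%nat) as [h Hh].
  { destruct (Nat.Even_or_Odd n) as [[m Hm]|[m Hm]]; [exists m|exists (S m)]; lia. }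
  exists (firstn h B), (skipn h B).
  rewrite <- (firstn_skipn h B) in HB, Hk.
  pose proof (firstn_le_length h B). pose proof (length_firstn h B). pose proof (length_skipn h B).
  split; [|split; [|symmetry; apply firstn_skipn]].
  - split; [eapply NoDup_app_remove_r; eauto|]. intros k Hin.
    specialize (Hk k (in_or_app _ _ _ (or_introl Hin))). lia.
  - split; [eapply NoDup_app_remove_l; eauto|]. intros k Hin.
    specialize (Hk k (in_or_app _ _ _ (or_intror Hin))). lia.
Qed.

Theorem proposition2 :
  exists K : R, 0 < K /\
    forall n : nat, (1 <= n)%nat ->
      E_property (derived_norm schreier2) derived_basis n n K.
Proof.
  exists (40 * PI). pose proof PI2_1 as HPI.
  split; [lra|]. intros n _.
  exists (seq 0 n). split; [apply seq_NoDup|]. split; [apply length_seq|].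
  intros A HA Hlen HAn a.
  set (B := nodup Nat.eq_dec (map Nat.div2 A)).
  assert (HB : NoDup B) by apply NoDup_nodup.
  assert (HinB : forall j, In j A -> In (Nat.div2 j) B).
  { intros j Hj. apply nodup_In, in_map, Hj. }
  destruct (split_admissible n B HB) as [A1 [A2 [H1 [H2 E]]]].
  { apply Nat.le_trans with (length (map Nat.div2 A)); [|rewrite length_map; exact Hlen].
    apply NoDup_incl_length; [exact HB|]. intros k Hk. apply nodup_In in Hk. exact Hk. }
  { intros k Hk. apply nodup_In, in_map_iff in Hk as [j [<- Hj]].
    specialize (HAn j Hj). rewrite in_seq in HAn.
    pose proof (Nat.div2_odd j). destruct (Nat.odd j); simpl Nat.b2n in *; lia. }
  set (x := fst (lincomb A a derived_basis)). set (y := snd (lincomb A a derived_basis)).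
  change (lincomb A a derived_basis) with (x, y).
  assert (Ex : forall k, x k = restrict A a (2 * k)%nat) by (intros; apply lincomb_fst; auto).
  assert (Ey : forall k, y k = restrict A a (2 * k + 1)%nat) by (intros; apply lincomb_snd; auto).
  assert (Hx : supported_on B x).
  { intros k Hk. rewrite Ex. apply restrict_notin. intros I.
    apply Hk. rewrite <- (Nat.div2_double k). auto. }
  assert (Hy : supported_on B y).
  { intros k Hk. rewrite Ey. apply restrict_notin. intros I.
    apply Hk. apply HinB in I. rewrite Nat.add_1_r, Nat.div2_succ_double in I. exact I. }
  assert (Nx : l2_norm B x = l2_norm (map (fun k => 2 * k)%nat B) (restrict A a)).
  { rewrite l2_norm_map. apply l2_norm_ext. auto. }
  assert (Ny : l2_norm B y = l2_norm (map (fun k => 2 * k + 1)%nat B) (restrict A a)).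
  { rewrite l2_norm_map. apply l2_norm_ext. auto. }
  assert (Ux : l2_norm B x <= l2_norm A a).
  { rewrite Nx. apply l2_norm_restrict_le. apply FinFun.Injective_map_NoDup; auto.
    intros i j; lia. }
  assert (Uy : l2_norm B y <= l2_norm A a).
  { rewrite Ny. apply l2_norm_restrict_le. apply FinFun.Injective_map_NoDup; auto.
    intros i j; lia. }
  assert (Lxy : l2_norm A a <= l2_norm B x + l2_norm B y).
  { rewrite Nx, Ny. eapply Rle_trans; [|apply l2_norm_app].
    rewrite (l2_norm_ext A a (restrict A a)) by (intros; symmetry; apply restrict_in; auto).
    apply l2_norm_le_of_support; auto. intros j Hj _.
    pose proof (Nat.div2_odd j) as Hd. apply in_or_app.
    destruct (Nat.odd j); simpl Nat.b2n in Hd; [right|left]; apply in_map_iff;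
      exists (Nat.div2 j); split; auto; lia. }
  rewrite E in HB, Hx, Hy, Ux, Uy, Lxy.
  destruct (derived_norm_bounds A1 A2 x y H1 H2 HB Hx Hy) as [D1 D2].
  split.
  - eapply Rbar_le_trans; [|exact D1]. simpl.
    apply Rmult_le_compat_l; [|exact Lxy]. apply Rlt_le, Rinv_0_lt_compat. lra.
  - eapply Rbar_le_trans; [exact D2|]. simpl.
    pose proof (l2_norm_nonneg A a). nra.
Qed.
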